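(* Let $F$ be a field, $R$ a Hopf $F$-algebra which is finitely generated as an $F$-algebra, and $T=R[x;\sigma,\delta]$ a Hopf Ore extension of $R$ such that $S(x)=\alpha x+\beta$ for some $\alpha,\beta\in R$ with $\alpha$ a unit of $R$. Then $\mathrm{GKdim}\,T=\mathrm{GKdim}\,R+1$.
   Context: Hopf algebras have bijective antipode. A Hopf Ore extension of $R$ is a Hopf $F$-algebra $T$ containing $R$ as a Hopf subalgebra with $T=R[x;\sigma,\delta]$ (skew polynomial algebra: $xr-\sigma(r)x=\delta(r)$, $\sigma$ an automorphism, $\delta$ a $\sigma$-derivation) and $\Delta(x)=a\otimes x+x\otimes b+v(x\otimes x)+w$ for some $a,b\in R$, $v,w\in R\otimes R$. GKdim denotes Gelfand–Kirillov dimension. *)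

(* Defs.v *)
From HB Require Import structures.
From mathcomp Require Import all_boot all_order all_algebra.
From mathcomp Require Import boolp classical_sets reals ereal sequences exp.
From mathcomp Require Import Rstruct.

Set Implicit Arguments.
Unset Strict Implicit.
Unset Printing Implicit Defensive.

Import Order.TTheory GRing.Theory Num.Theory.
Local Open Scope ring_scope.

Section HopfOre.
Variable F : fieldType.

Definition lin (U V : lmodType F) (f : U -> V) : Prop :=
  forall (a : F) (u v : U), f (a *: u + v) = a *: f u + f v.

Definition bilin (U V W : lmodType F) (f : U -> V -> W) : Prop :=
  (forall v, lin (fun u => f u v)) /\ (forall u, lin (f u)).

Definition trilin (U V W X : lmodType F) (f : U -> V -> W -> X) : Prop :=
  (forall v w, lin (fun u => f u v w)) /\ (forall u w, lin (fun v => f u v w))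
  /\ (forall u v, lin (f u v)).

Definition in_span (V : lmodType F) (L : seq V) (v : V) : Prop :=
  exists c : seq F, v = \sum_(i < size L) c`_i *: L`_i.

(* TT is H (x) H (with its algebra structure (a(x)b)(c(x)d) = ac (x) bd),
   TTT is H (x) H (x) H. *)
Record tensor_data (H : algType F) := TensorData {
  TT : algType F;
  TTT : lmodType F;
  t2 : H -> H -> TT;
  t3 : H -> H -> H -> TTT }.

Definition is_tensor_data (H : algType F) (X : tensor_data H) : Prop :=
  [/\ bilin (t2 X),
      (forall (Y : lmodType F) (f : H -> H -> Y), bilin f ->
         exists g : TT X -> Y, lin g /\ forall a b, g (t2 X a b) = f a b)
      /\ (forall z : TT X, exists la lb : seq H,
             size la = size lb /\ z = \sum_(i < size la) t2 X la`_i lb`_i),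
      (forall a b c d, t2 X a b * t2 X c d = t2 X (a * c) (b * d))
      /\ (1 : TT X) = t2 X 1 1,
      trilin (t3 X) &
      (forall (Y : lmodType F) (f : H -> H -> H -> Y), trilin f ->
         exists g : TTT X -> Y, lin g /\ forall a b c, g (t3 X a b c) = f a b c)
      /\ (forall z : TTT X, exists la lb lc : seq H,
             [/\ size la = size lb, size lb = size lc &
                 z = \sum_(i < size la) t3 X la`_i lb`_i lc`_i])].

Section Hopf.
Variables (H : algType F) (X : tensor_data H).
Variables (Delta : H -> TT X) (eps : H -> F) (S : H -> H).

Definition is_alg_hom_TT (f : H -> TT X) : Prop :=
  [/\ lin f, forall a b, f (a * b) = f a * f b & f 1 = 1].

(* coassociativity: (Delta (x) id) o Delta = (id (x) Delta) o Delta, where the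
   maps Delta (x) id, id (x) Delta : H(x)H -> H(x)H(x)H are described through
   the universal property (they are uniquely determined by these equations) *)
Definition coassociative : Prop :=
  exists (M1 : TT X -> H -> TTT X) (M2 : H -> TT X -> TTT X)
         (D1 D2 : TT X -> TTT X),
    [/\ (forall c, lin (fun z => M1 z c)) /\
        (forall a b c, M1 (t2 X a b) c = t3 X a b c),
        (forall c, lin (M2 c)) /\
        (forall a b c, M2 a (t2 X b c) = t3 X a b c),
        lin D1 /\ (forall a b, D1 (t2 X a b) = M1 (Delta a) b),
        lin D2 /\ (forall a b, D2 (t2 X a b) = M2 a (Delta b)) &
        forall h, D1 (Delta h) = D2 (Delta h)].

Definition counital : Prop :=
  exists E1 E2 : TT X -> H,
    [/\ lin E1, (forall a b, E1 (t2 X a b) = eps a *: b),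
        lin E2, (forall a b, E2 (t2 X a b) = eps b *: a) &
        forall h, E1 (Delta h) = h /\ E2 (Delta h) = h].

Definition antipodal : Prop :=
  exists A1 A2 : TT X -> H,
    [/\ lin A1, (forall a b, A1 (t2 X a b) = S a * b),
        lin A2, (forall a b, A2 (t2 X a b) = a * S b) &
        forall h, A1 (Delta h) = eps h *: 1 /\ A2 (Delta h) = eps h *: 1].

Definition is_hopf : Prop :=
  [/\ is_tensor_data X /\ is_alg_hom_TT Delta,
      [/\ lin (fun (h : H) => (eps h : F^o)), (forall a b, eps (a * b) = eps a * eps b)
          & eps 1 = 1],
      coassociative /\ counital, antipodal & bijective S].

Definition in_tensor2 (R : {pred H}) (z : TT X) : Prop :=
  exists la lb : seq H, [/\ size la = size lb, {subset la <= R}, {subset lb <= R} &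
    z = \sum_(i < size la) t2 X la`_i lb`_i].

Definition is_subalgebra (R : {pred H}) : Prop :=
  [/\ 1 \in R, (forall a b, a \in R -> b \in R -> a + b \in R),
      (forall a b, a \in R -> b \in R -> a * b \in R) &
      (forall (c : F) a, a \in R -> c *: a \in R)].

(* Hopf subalgebra (with bijective antipode in its own right) *)
Definition is_hopf_subalgebra (R : {pred H}) : Prop :=
  [/\ is_subalgebra R, (forall r, r \in R -> in_tensor2 R (Delta r)),
      (forall r, r \in R -> S r \in R) &
      (forall r, r \in R -> exists r', r' \in R /\ S r' = r)].

End Hopf.

Section Ore.
Variables (T : algType F) (R : {pred T}) (sigma delta : T -> T) (x : T).

Definition is_automorphism_on : Prop :=
  [/\ forall r, r \in R -> sigma r \in R,
      forall r, r \in R -> exists r', r' \in R /\ sigma r' = r,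
      {in R &, injective sigma} /\
      {in R &, forall a b, sigma (a * b) = sigma a * sigma b},
      sigma 1 = 1 &
      (forall (c : F) a b, a \in R -> b \in R -> sigma (c *: a + b) = c *: sigma a + sigma b)].

Definition is_sigma_derivation_on : Prop :=
  [/\ forall r, r \in R -> delta r \in R,
      (forall (c : F) a b, a \in R -> b \in R -> delta (c *: a + b) = c *: delta a + delta b) &
      {in R &, forall a b, delta (a * b) = sigma a * delta b + delta a * b}].

Definition is_ore_extension : Prop :=
  [/\ is_subalgebra R /\ is_automorphism_on, is_sigma_derivation_on,
      (forall r, r \in R -> x * r - sigma r * x = delta r),
      (forall t : T, exists rs : seq T, {subset rs <= R} /\
          t = \sum_(i < size rs) rs`_i * x ^+ i) &
      (forall rs : seq T, {subset rs <= R} ->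
          \sum_(i < size rs) rs`_i * x ^+ i = 0 -> forall i, rs`_i = 0)].

End Ore.

Section GK.
Variable A : algType F.

Definition lin_indep (L : seq A) : Prop :=
  forall c : seq F, size c = size L ->
    \sum_(i < size L) c`_i *: L`_i = 0 -> forall i, c`_i = 0.

Definition dim_span (L : seq A) : nat :=
  (\max_(m : (size L).-tuple bool | `[< lin_indep (mask m L) >]) count id m)%N.

Fixpoint words (V : seq A) (n : nat) : seq (seq A) :=
  if n is n'.+1 then [seq a :: w | a <- V, w <- words V n'] else [:: [::]].

(* spanning family of V^n, V = span (1 :: s) *)
Definition powV (s : seq A) (n : nat) : seq A :=
  [seq \prod_(a <- w) a | w <- words (1 :: s) n].

Definition fin_gen_subalgebra (R : {pred A}) : Prop :=
  exists s : seq A, {subset s <= R} /\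
    forall r, r \in R -> exists n, in_span (powV s n) r.

Definition GKdim (R : {pred A}) : \bar Rdefinitions.R :=
  ereal_sup [set limn_esup (fun n : nat =>
                 ((ln ((dim_span (powV s n))%:R : Rdefinitions.R)
                   / ln (n%:R : Rdefinitions.R))%:E))
            | s in [set s : seq A | {subset s <= R}]].

End GK.
End HopfOre.

(* Main.v *)
(* Evaluating the antipode, counit and coassociativity axioms at x and comparing
   coefficients of powers of x shows that b is a unit and that
   b^-1 sigma(r) b = sum chi(r_1) r_2 for the functional chi = eps o sigma on R.
   Hence y = b^-1 x satisfies y r = sigma'(r) y + delta'(r), where the automorphism
   sigma' is a winding map and so preserves a finite-dimensional generating space
   of R. For such a sigma' the derivation delta' raises degrees by a bounded amount,
   so giving y a large enough weight yields dim V^n <= (nN + 1) dim L^(nN) for every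
   finite V in T, with a fixed finite L in R; conversely, the elements q x^i with
   q in V^n and i <= n show dim (V + Fx)^(2n) >= (n + 1) dim V^n for V in R. *)
Require Import Defs.
From HB Require Import structures.
From mathcomp Require Import all_boot all_order all_algebra.
From mathcomp Require Import boolp classical_sets reals ereal sequences exp.
From mathcomp Require Import Rstruct lra.
Set Implicit Arguments.
Unset Strict Implicit.
Unset Printing Implicit Defensive.
Import Order.TTheory GRing.Theory Num.Theory.
Local Open Scope ring_scope.

(** For an arbitrary automorphism, no finite-dimensional generating space of [R] need be stable, and
    a skew extension may then grow far faster; the Hopf structure is there to exclude this, and only
    the upper bound uses it. The term [v * t2 X x x] of [Delta x] is not shown to vanish. It
    suffices that two contractions of [v] do: the sum of S(v_1) v_2, controlled by the coefficient
    of x^2 in the antipode identity (here the form of [S x] and the unit [alpha] enter), and the sum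
    of eps(v_1) v_2, killed through coassociativity. Coassociativity gives only a left inverse of
    [b]. The right inverse needs the relation between [S a] and [sigma b], read off from the
    coefficient of x in the antipode identity, and surjectivity of [sigma]. Tensors are reachable
    only through their universal property, so coefficients are compared by applying multilinear test
    maps made of [eps], [S] and the coefficient functions of the powers of x. Both dimension
    estimates compare index n with a multiple nN, which is harmless because ln(nN)/ln n tends to
    1. *)

Section LinearMaps.
Variables (F : fieldType) (U V : lmodType F).
Implicit Types f : U -> V.

Lemma lin0 f : lin f -> f 0 = 0.
Proof. by move=> fl; have := fl (-1) 0 0; rewrite !scaleN1r !addNr. Qed.

Lemma linD f u v : lin f -> f (u + v) = f u + f v.
Proof. by move=> fl; rewrite -[u]scale1r fl !scale1r. Qed.

Lemma linZ f k u : lin f -> f (k *: u) = k *: f u.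
Proof. by move=> fl; rewrite -[k *: u]addr0 fl lin0 // addr0. Qed.

Lemma lin_bigsum f (I : Type) (r : seq I) (P : pred I) (g : I -> U) : lin f ->
  f (\sum_(i <- r | P i) g i) = \sum_(i <- r | P i) f (g i).
Proof.
by move=> fl; apply: big_morph => [u v|]; [apply: linD|apply: lin0].
Qed.

End LinearMaps.

(** * Spans of finite families *)

Section Span.
Variables (F : fieldType) (V : lmodType F).
Implicit Types (L M : seq V) (u v : V).

Lemma in_span0 L : in_span L 0.
Proof.
by exists [::]; rewrite big1 // => i _; rewrite nth_nil scale0r.
Qed.

Lemma in_spanD L u v : in_span L u -> in_span L v -> in_span L (u + v).
Proof.
move=> [c ->] [d ->]; exists (mkseq (fun i => c`_i + d`_i) (size L)).
by rewrite -big_split /=; apply: eq_bigr => i _; rewrite nth_mkseq // scalerDl.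
Qed.

Lemma in_spanZ L k v : in_span L v -> in_span L (k *: v).
Proof.
move=> [c ->]; exists (mkseq (fun i => k * c`_i) (size L)).
by rewrite scaler_sumr; apply: eq_bigr => i _; rewrite nth_mkseq // scalerA.
Qed.

Lemma in_span_mem L v : v \in L -> in_span L v.
Proof.
move=> vL; have iL : (index v L < size L)%N by rewrite index_mem.
exists (mkseq (fun i => (i == index v L)%:R) (size L)).
rewrite (bigD1 (Ordinal iL)) //= nth_mkseq // eqxx scale1r nth_index //.
rewrite big1 ?addr0 // => i ni; rewrite nth_mkseq //.
by rewrite -[_ == _]/(i == Ordinal iL) (negbTE ni) scale0r.
Qed.

Lemma in_span_sum L (I : Type) (r : seq I) (P : pred I) (f : I -> V) :
  (forall i, P i -> in_span L (f i)) -> in_span L (\sum_(i <- r | P i) f i).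
Proof.
by move=> h; elim/big_ind: _ => //; [exact: in_span0|move=> u v; exact: in_spanD].
Qed.

Lemma in_span_trans L M v :
  (forall u, u \in L -> in_span M u) -> in_span L v -> in_span M v.
Proof.
move=> h [c ->]; apply: in_span_sum => i _; apply: in_spanZ; apply: h.
exact: mem_nth.
Qed.

Lemma in_span_sub L M v : {subset L <= M} -> in_span L v -> in_span M v.
Proof. by move=> h; apply: in_span_trans => u /h; apply: in_span_mem. Qed.

End Span.

Lemma in_span_lin (F : fieldType) (V W : lmodType F) (f : V -> W) (L : seq V) (M : seq W) v :
  lin f -> (forall u, u \in L -> in_span M (f u)) -> in_span L v -> in_span M (f v).
Proof.
move=> fl h [c ->]; rewrite lin_bigsum //; apply: in_span_sum => i _.
by rewrite linZ //; apply: in_spanZ; apply: h; apply: mem_nth.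
Qed.

(** * Dimension of a finite span *)

Section Dimension.
Variables (F : fieldType) (A : algType F).
Implicit Types (L M : seq A).

(** Otherwise the coordinate matrix has more rows than columns, and a nonzero vector of its left
    kernel is a linear relation on [L]. *)
Lemma lin_indep_size_le L M :
  lin_indep L -> (forall u, u \in L -> in_span M u) -> (size L <= size M)%N.
Proof.
move=> indL LM; rewrite leqNgt; apply/negP => ltML.
have /choice [c cP] : forall i : 'I_(size L), exists c : seq F,
    L`_i = \sum_(j < size M) c`_j *: M`_j.
  by move=> i; apply: LM; apply: mem_nth.
pose B : 'M[F]_(size L, size M) := \matrix_(i, j) (c i)`_j.
have : ~~ row_free B.
  by rewrite /row_free neq_ltn (leq_ltn_trans (rank_leq_col B) ltML).
rewrite -kermx_eq0 => /rowV0Pn [u /sub_kermxP uB /eqP]; apply.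
have := indL (mkseq (fun i => oapp (u 0) 0 (insub i)) (size L)).
rewrite size_mkseq => /(_ erefl) h.
apply/rowP => i; rewrite mxE.
have : \sum_(k < size L) (mkseq (fun i => oapp (u 0) 0 (insub i)) (size L))`_k *: L`_k = 0.
  rewrite (eq_bigr (fun k => \sum_(j < size M) (u 0 k * B k j) *: M`_j)).
    rewrite exchange_big /= big1 // => j _; rewrite -scaler_suml.
    by have /rowP/(_ j) := uB; rewrite !mxE => ->; rewrite scale0r.
  move=> k _; rewrite nth_mkseq // valK /= [L`_k]cP scaler_sumr.
  by apply: eq_bigr => j _; rewrite scalerA mxE.
by move=> /h /(_ i); rewrite nth_mkseq // valK.
Qed.

Lemma lin_indep_cons L v : lin_indep L -> ~ in_span L v -> lin_indep (v :: L).
Proof.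
move=> indL vL [//|k c] /= [sz]; rewrite big_ord_recl /=.
have [->|k0] := eqVneq k 0.
  by rewrite scale0r add0r => /(indL _ sz) c0 [|i] /=.
move=> h; case: vL.
have -> : v = \sum_(i < size L) (- k^-1 * c`_i) *: L`_i.
  under eq_bigr do rewrite -scalerA.
  rewrite -scaler_sumr -[X in _ *: X](addKr (k *: v)) h addr0.
  by rewrite scalerN scaleNr opprK scalerA mulVf // scale1r.
by apply: in_span_sum => i _; apply: in_spanZ; apply: in_span_mem; apply: mem_nth.
Qed.

(** Greedy choice from the right end. The basis has to be a mask because [dim_span] is a maximum
    over masks. *)
Lemma exists_basis_mask L : exists m : (size L).-tuple bool,
  lin_indep (mask m L) /\ forall u, u \in L -> in_span (mask m L) u.
Proof.
elim: L => [|v L [m [mi ms]]]; first by exists [tuple]; split => // -[] // _ _ i; rewrite nth_nil.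
have [vL|vL] := pselect (in_span (mask m L) v).
  exists [tuple of false :: m]; split => //= u; rewrite inE => /orP[/eqP->//|/ms//].
exists [tuple of true :: m]; split => /=; first exact: lin_indep_cons.
move=> u; rewrite inE => /orP[/eqP->|/ms].
  by apply: in_span_mem; rewrite inE eqxx.
by apply: in_span_sub => z; rewrite inE orbC => ->.
Qed.

Lemma exists_basis L : exists B : seq A,
  [/\ {subset B <= L}, lin_indep B, size B = Defs.dim_span L
    & forall u, u \in L -> in_span B u].
Proof.
have [m [mi ms]] := exists_basis_mask L.
exists (mask m L); split => //; first by move=> u; apply: mem_mask.
apply/eqP; rewrite eqn_leq; apply/andP; split.
  rewrite size_mask ?size_tuple //.
  by apply: leq_bigmax_cond; apply/asboolP.
apply/bigmax_leqP => m' /asboolP mi'.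
rewrite -(@size_mask _ _ L) ?size_tuple //; apply: lin_indep_size_le => // u.
by move=> /mem_mask /ms.
Qed.

Lemma dim_span_ge L M : lin_indep L -> (forall u, u \in L -> in_span M u) ->
  (size L <= Defs.dim_span M)%N.
Proof.
have [B [_ _ <- BM]] := exists_basis M => Li LM.
apply: lin_indep_size_le => // u /LM; exact: in_span_trans.
Qed.

Lemma dim_span_le L M : (forall u, u \in L -> in_span M u) ->
  (Defs.dim_span L <= size M)%N.
Proof.
have [B [BL Bi <- _]] := exists_basis L => LM.
by apply: lin_indep_size_le => // u /BL/LM.
Qed.

End Dimension.

(** * Powers of a generating space *)

Section Powers.
Variables (F : fieldType) (A : algType F).
Implicit Types (s L : seq A) (n : nat) (z : A).

Lemma wordsP s n (w : seq A) :
  reflect (size w = n /\ {subset w <= s}) (w \in words s n).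
Proof.
elim: n w => [|n IH] w /=.
  rewrite inE; apply: (iffP eqP) => [->//|[]]; by case: w.
apply: (iffP allpairsP) => [[[u w'] /= [us /IH[<- ws] ->]]|].
  by split => // z; rewrite inE => /orP[/eqP->//|/ws].
case: w => [|u w] [] //= [sw] ws; exists (u, w) => /=; split => //.
  by apply: ws; rewrite inE eqxx.
by apply/IH; split => // z zw; apply: ws; rewrite inE zw orbT.
Qed.

Lemma powVP s n z : reflect
  (exists w, [/\ size w = n, {subset w <= 1 :: s} & z = \prod_(u <- w) u])
  (z \in powV s n).
Proof.
apply: (iffP mapP) => [[w /wordsP[sw ws] ->]|[w [sw ws ->]]]; exists w => //.
exact/wordsP.
Qed.

Lemma powV_prod s n (w : seq A) : (size w <= n)%N -> {subset w <= 1 :: s} ->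
  \prod_(u <- w) u \in powV s n.
Proof.
(* Shorter words are padded with the letter [1]. *)
move=> sw ws; apply/powVP; exists (w ++ nseq (n - size w) 1); split.
- by rewrite size_cat size_nseq subnKC.
- move=> z; rewrite mem_cat => /orP[/ws//|]; rewrite mem_nseq => /andP[_ /eqP->].
  by rewrite inE eqxx.
- by rewrite big_cat /= [X in _ * X]big1_seq ?mulr1 // => i /andP[_]; rewrite mem_nseq => /andP[_ /eqP].
Qed.

(** Combinations of products of at most [n] elements of [U]. [U] is a predicate and not a list
    because it will be the infinite set of all slices of the generators, which is stable under the
    winding map and lies in a finite span. *)
Inductive gen (U : A -> Prop) : nat -> A -> Prop :=
| gen_one n : gen U n 1
| gen_add n p q : gen U n p -> gen U n q -> gen U n (p + q)
| gen_scale n k p : gen U n p -> gen U n (k *: p)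
| gen_mul n u p : U u -> gen U n p -> gen U n.+1 (u * p).

Lemma gen_zero U n : gen U n 0.
Proof. by rewrite -(scale0r 1); apply/gen_scale/gen_one. Qed.

Lemma gen_mono U n m p : (n <= m)%N -> gen U n p -> gen U m p.
Proof.
move=> nm H; elim: H m nm => {n p} [n|n p q _ IHp _ IHq|n k p _ IH|n u p uU _ IH] m nm.
- exact: gen_one.
- by apply: gen_add; [apply: IHp|apply: IHq].
- by apply: gen_scale; apply: IH.
- by case: m nm => // m nm; apply: gen_mul => //; apply: IH.
Qed.

Lemma gen_prod U n m p q : gen U n p -> gen U m q -> gen U (n + m) (p * q).
Proof.
move=> H hq; elim: H => {n p} [n|n p p' _ IH _ IH'|n k p _ IH|n u p uU _ IH].
- by rewrite mul1r; apply: gen_mono hq; rewrite leq_addl.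
- by rewrite mulrDl; apply: gen_add.
- by rewrite -scalerAl; apply: gen_scale.
- by rewrite -mulrA addSn; apply: gen_mul.
Qed.

Lemma in_span_mull L M (u z : A) :
  (forall l, l \in L -> in_span M (u * l)) -> in_span L z -> in_span M (u * z).
Proof.
by move=> h; apply: (@in_span_lin _ _ _ (fun z => u * z)) => // k z1 z2;
  rewrite mulrDr scalerAr.
Qed.

Lemma in_span_mulr L M (u z : A) :
  (forall l, l \in L -> in_span M (l * u)) -> in_span L z -> in_span M (z * u).
Proof.
by move=> h; apply: (@in_span_lin _ _ _ (fun z => z * u)) => // k z1 z2;
  rewrite mulrDl scalerAl.
Qed.

Lemma gen_in_span U L n p : (forall u, U u -> in_span L u) -> gen U n p ->
  in_span (powV L n) p.
Proof.
move=> UL; elim=> {n p} [n|n p q _ ? _ ?|n k p _ ?|n u p /UL uL _ IH].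
- apply: in_span_mem; have -> : 1 = \prod_(u <- [::]) u :> A by rewrite big_nil.
  exact: powV_prod.
- exact: in_spanD.
- exact: in_spanZ.
- apply: in_span_mull IH => q /powVP[w [sw ws ->]].
  apply: in_span_mulr uL => l lL; apply: in_span_mem.
  have -> : l * \prod_(v <- w) v = \prod_(v <- l :: w) v by rewrite big_cons.
  apply: powV_prod; rewrite /= ?sw // => z.
  by rewrite inE => /orP[/eqP->|/ws//]; rewrite inE lL orbT.
Qed.

Lemma in_span_powV_gen (U : A -> Prop) s n p : (forall u, u \in s -> U u) ->
  in_span (powV s n) p -> gen U n p.
Proof.
move=> sU [c ->]; elim/big_ind: _ => [|? ?|i _]; [exact: gen_zero|exact: gen_add|].
apply: gen_scale; have := mem_nth 0 (ltn_ord i); move: (_`_i) => q.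
case/powVP=> w [<- ws ->].
elim: w ws => [|u w IH] ws; first by rewrite big_nil; apply: gen_one.
have /IH {}IH : {subset w <= 1 :: s} by move=> z zw; apply: ws; rewrite inE zw orbT.
rewrite big_cons /=; have := ws u; rewrite !inE eqxx => /(_ isT)/orP[/eqP->|/sU uU].
  by rewrite mul1r; apply: gen_mono IH.
exact: gen_mul.
Qed.

End Powers.

Section Subalgebra.
Variables (F : fieldType) (A : algType F) (R : {pred A}).
Hypothesis Rsub : is_subalgebra R.

Lemma subalg1 : 1 \in R. Proof. by case: Rsub. Qed.
Lemma subalgD p q : p \in R -> q \in R -> p + q \in R.
Proof. by case: Rsub => _ h _ _; apply: h. Qed.
Lemma subalgM p q : p \in R -> q \in R -> p * q \in R.
Proof. by case: Rsub => _ _ h _; apply: h. Qed.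
Lemma subalgZ (k : F) p : p \in R -> k *: p \in R.
Proof. by case: Rsub => _ _ _ h; apply: h. Qed.
Lemma subalg0 : 0 \in R. Proof. by rewrite -(scale0r 1) subalgZ // subalg1. Qed.
Lemma subalgN p : p \in R -> - p \in R. Proof. by rewrite -scaleN1r; apply: subalgZ. Qed.
Lemma subalg_sum (I : Type) (r : seq I) (P : pred I) (f : I -> A) :
  (forall i, P i -> f i \in R) -> \sum_(i <- r | P i) f i \in R.
Proof. by move=> h; elim/big_ind: _; [exact: subalg0|exact: subalgD|]. Qed.
Lemma subalg_span L z : {subset L <= R} -> in_span L z -> z \in R.
Proof. by move=> LR [c ->]; apply: subalg_sum => i _; apply/subalgZ/LR/mem_nth. Qed.
Lemma subalg_nth (s : seq A) i : {subset s <= R} -> s`_i \in R.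
Proof.
move=> sR; have [/(mem_nth 0)/sR//|h] := ltnP i (size s).
by rewrite nth_default // subalg0.
Qed.
Lemma subalg_powV s n z : {subset s <= R} -> z \in powV s n -> z \in R.
Proof.
move=> sR /powVP[w [_ ws ->]]; rewrite big_seq; elim/big_ind: _ => [|p q|i /ws].
- exact: subalg1.
- exact: subalgM.
- by rewrite inE => /orP[/eqP->|/sR//]; apply: subalg1.
Qed.

End Subalgebra.

(** * Upper growth bound when the automorphism preserves a generating set *)

Section Upper.
Variables (F : fieldType) (A : algType F) (R : {pred A}).
Variables (sg dl : A -> A) (x y b : A) (U : A -> Prop) (L : seq A).
Hypothesis Rsub : is_subalgebra R.
Hypothesis LR : {subset L <= R}.
Hypothesis UL : forall u, U u -> in_span L u.
Hypothesis Usg : forall u, U u -> U (sg u).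
Hypothesis Rgen : forall r, r \in R -> exists n, gen U n r.
Hypothesis bR : b \in R.
Hypothesis xE : x = b * y.
Hypothesis yr : forall r, r \in R -> y * r = sg r * y + dl r.
Hypothesis sg1 : sg 1 = 1.
Hypothesis sgL : forall k p q, p \in R -> q \in R -> sg (k *: p + q) = k *: sg p + sg q.
Hypothesis sgM : forall p q, p \in R -> q \in R -> sg (p * q) = sg p * sg q.
Hypothesis dlR : forall r, r \in R -> dl r \in R.
Hypothesis dlL : forall k p q, p \in R -> q \in R -> dl (k *: p + q) = k *: dl p + dl q.
Hypothesis dlM : forall p q, p \in R -> q \in R -> dl (p * q) = sg p * dl q + dl p * q.
Hypothesis span_x : forall t : A, exists rs : seq A, {subset rs <= R} /\
  t = \sum_(i < size rs) rs`_i * x ^+ i.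

Let R1 := subalg1 Rsub.
Let RD := subalgD Rsub.
Let RM := subalgM Rsub.
Let RZ := subalgZ Rsub.
Let R0 := subalg0 Rsub.
Let span_R z := @subalg_span _ _ _ Rsub L z LR.

Let gen_R n p : gen U n p -> p \in R.
Proof.
elim=> {n p} [n|*|*|n u p /UL/span_R uR _ pR]; [exact: R1|exact: RD|exact: RZ|exact: RM].
Qed.

Let sg0 : sg 0 = 0.
Proof. by have := sgL (-1) R0 R0; rewrite !scaleN1r !addNr. Qed.
Let dl0 : dl 0 = 0.
Proof. by have := dlL (-1) R0 R0; rewrite !scaleN1r !addNr. Qed.
Let dl1 : dl 1 = 0.
Proof. by have := dlM R1 R1; rewrite sg1 !mulr1 mul1r => /esym/eqP; rewrite -subr_eq0 addrK => /eqP. Qed.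
Let sgZ k p : p \in R -> sg (k *: p) = k *: sg p.
Proof. by move=> pR; rewrite -[k *: p]addr0 sgL // sg0 addr0. Qed.
Let sgD p q : p \in R -> q \in R -> sg (p + q) = sg p + sg q.
Proof. by move=> pR qR; rewrite -[p]scale1r sgL // !scale1r. Qed.
Let dlZ k p : p \in R -> dl (k *: p) = k *: dl p.
Proof. by move=> pR; rewrite -[k *: p]addr0 dlL // dl0 addr0. Qed.
Let dlD p q : p \in R -> q \in R -> dl (p + q) = dl p + dl q.
Proof. by move=> pR qR; rewrite -[p]scale1r dlL // !scale1r. Qed.

Lemma gen_sg n p : gen U n p -> gen U n (sg p).
Proof.
elim=> {n p} [n|n p q /gen_R pR ? /gen_R qR ?|n k p /gen_R pR ?|n u p uU /gen_R pR ?].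
- by rewrite sg1; apply: gen_one.
- by rewrite sgD //; apply: gen_add.
- by rewrite sgZ //; apply: gen_scale.
- by rewrite sgM ?(span_R (UL uU)) //; apply: gen_mul => //; apply: Usg.
Qed.

(** In [dl (u * p) = sg u * dl p + dl u * p] the factor [sg u] lies again in [U], so the increase
    does not accumulate along a product: it is bounded by the degrees of [dl] on the finite list
    [L]. *)
Lemma gen_dl : exists K, (0 < K)%N /\ forall n p, gen U n p -> gen U (n + K) (dl p).
Proof.
have /(_ L LR) [K KL] : forall L' : seq A, {subset L' <= R} ->
    exists K, forall l, l \in L' -> gen U K (dl l).
  elim=> [|l L' IH] L'R; first by exists 0%N.
  have [|K KL] := IH; first by move=> z zL; apply: L'R; rewrite inE zL orbT.
  have [n ln] : exists n, gen U n (dl l) by apply/Rgen/dlR/L'R; rewrite inE eqxx.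
  exists (maxn n K) => z; rewrite inE => /orP[/eqP->|/KL zK].
    by apply: gen_mono ln; rewrite leq_maxl.
  by apply: gen_mono zK; rewrite leq_maxr.
(* The successor makes the increase positive, as required of the weight of [y]. *)
exists K.+1; split => // n p.
have KU u : U u -> gen U K (dl u).
  move=> /UL [c ->]; set z := \sum_(_ < _) _.
  (* Membership in [R] is carried along because [dl] is linear only there. *)
  suff: z \in R /\ gen U K (dl z) by case.
  rewrite /z; elim/big_ind: _ => [|p' q' [pR pK] [qR qK]|i _].
  - by split => //; rewrite dl0; apply: gen_zero.
  - by rewrite dlD //; split; [exact: RD|exact: gen_add].
  - have iL : L`_i \in L by apply: mem_nth.
    have iR := LR iL.
    by rewrite dlZ //; split; [exact: RZ|apply: gen_scale; exact: KL].
elim=> {n p} [n|n p q /gen_R pR ? /gen_R qR ?|n k p /gen_R pR ?|n u p uU pn ?].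
- by rewrite dl1; apply: gen_zero.
- by rewrite dlD //; apply: gen_add.
- by rewrite dlZ //; apply: gen_scale.
- rewrite dlM ?(span_R (UL uU)) ?(gen_R pn) //; apply: gen_add.
    by rewrite addSn; apply: gen_mul => //; apply: Usg.
  rewrite addSnnS addnC; apply: gen_prod => //; apply: gen_mono (KU _ uU).
  by rewrite leqW.
Qed.

(* Filtration by weight, where elements of U have weight 1 and y has weight K. *)
Inductive wfil (K : nat) : nat -> A -> Prop :=
| wfil_term n k i p : gen U k p -> (k + i * K <= n)%N -> wfil K n (p * y ^+ i)
| wfil_add n p q : wfil K n p -> wfil K n q -> wfil K n (p + q).

Lemma wfil_mono K n m p : (n <= m)%N -> wfil K n p -> wfil K m p.
Proof.
move=> nm H; elim: H nm => {n p} [n k i p pk kn nm|n p q _ IHp _ IHq nm].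
  by apply: wfil_term pk _; apply: leq_trans nm.
by apply: wfil_add; [apply: IHp|apply: IHq].
Qed.

Lemma wfil_gen K n p : gen U n p -> wfil K n p.
Proof. by move=> pn; rewrite -[p]mulr1 -(expr0 y); apply: wfil_term pn _; rewrite addn0. Qed.

Lemma wfil_mull K k n p q : gen U k p -> wfil K n q -> wfil K (k + n) (p * q).
Proof.
move=> pk; elim=> {n q} [n j i q qj jn|n q q' _ ? _ ?].
  by rewrite mulrA; apply: wfil_term (gen_prod pk qj) _; rewrite -addnA leq_add2l.
by rewrite mulrDr; apply: wfil_add.
Qed.

(** Moving [y] past a coefficient [q] yields [sg q * y], where [sg q] has no higher degree, and
    [dl q], whose gain in degree is at most the weight [K] of the lost [y]. *)
Lemma wfil_muly K n q : (forall n p, gen U n p -> gen U (n + K) (dl p)) ->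
  wfil K n q -> wfil K (n + K) (y * q).
Proof.
move=> hK; elim=> {n q} [n j i q qj jn|n q q' _ ? _ ?]; last first.
  by rewrite mulrDr; apply: wfil_add.
rewrite mulrA yr ?(gen_R qj) // mulrDl -mulrA -exprS; apply: wfil_add.
  by apply: wfil_term (gen_sg qj) _; rewrite mulSn addnCA addnC leq_add2r.
by apply: wfil_term (hK _ _ qj) _; rewrite addnAC leq_add2r.
Qed.

Lemma wfil_mul K n m p q : (forall n p, gen U n p -> gen U (n + K) (dl p)) ->
  wfil K n p -> wfil K m q -> wfil K (n + m) (p * q).
Proof.
move=> hK pn qm; elim: pn => {n p} [n k i p pk kn|n p p' _ ? _ ?]; last first.
  by rewrite mulrDl; apply: wfil_add.
rewrite -mulrA; apply: (@wfil_mono _ (k + (m + i * K))).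
  by rewrite addnCA addnC leq_add2r.
apply: wfil_mull => //; elim: i {kn} => [|i IH]; first by rewrite mul1r addn0.
by rewrite exprS -mulrA mulSn addnA addnAC; apply: wfil_muly.
Qed.

(** Since [y] has weight at least 1, weight [n] leaves only the exponents from 0 to [n], hence the
    factor [n.+1]; all coefficients lie in the span of [powV L n]. *)
Lemma wfil_in_span K n : (0 < K)%N ->
  exists2 M : seq A, forall q, wfil K n q -> in_span M q &
    (size M = n.+1 * Defs.dim_span (powV L n))%N.
Proof.
move=> K0; have [B [_ _ <- BL]] := exists_basis (powV L n).
exists [seq p * y ^+ i | i <- iota 0 n.+1, p <- B]; last first.
  by rewrite size_allpairs size_iota.
move=> q qn; set M := (X in in_span X _).
suff: forall m q, wfil K m q -> (m <= n)%N -> in_span M q by apply; [exact: qn|].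
move=> {q qn} m q; elim=> {m q} [m k i p pk km|m p q _ IHp _ IHq] mn; last first.
  by apply: in_spanD; [apply: IHp|apply: IHq].
have kn := leq_trans km mn.
have pB : in_span B p.
  apply: in_span_trans BL _; apply: gen_in_span UL _.
  by apply: gen_mono pk; apply: leq_trans kn; rewrite leq_addr.
apply: in_span_mulr pB => l lB; apply: in_span_mem; apply/allpairsP.
exists (i, l); split => //=; rewrite -[0%N :: _]/(iota 0 n.+1) mem_iota add0n ltnS.
apply: leq_trans kn; apply: leq_trans (leq_addl _ _); exact: leq_pmulr.
Qed.

(** [N] is a common weight bound for the elements of [s], so words of length [n] have weight at most
    [n * N]. *)
Lemma dim_powV_upper (s : seq A) : exists N, (0 < N)%N /\ forall n,
  (Defs.dim_span (powV s n) <= (n * N).+1 * Defs.dim_span (powV L (n * N)))%N.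
Proof.
have [K [K0 hK]] := gen_dl.
have yK : wfil K K y.
  have := @wfil_term K K 0 1 1 (gen_one _ _).
  by rewrite mul1r expr1 mul1n; apply.
have tW t : exists n, wfil K n t.
  have [rs [rsR ->]] := span_x t.
  elim/big_ind: _ => [|p q [n pn] [m qm]|i _].
  - by exists 0%N; apply/wfil_gen/gen_zero.
  - exists (maxn n m); apply: wfil_add.
      by apply: wfil_mono pn; rewrite leq_maxl.
    by apply: wfil_mono qm; rewrite leq_maxr.
  - have [n pn] := Rgen (rsR _ (mem_nth 0 (ltn_ord i))).
    have [m bm] := Rgen bR.
    have [j xj] : exists j, wfil K j (x ^+ i).
      elim: (nat_of_ord i) => [|j [k IH]]; first by exists 0%N; apply/wfil_gen/gen_one.
      exists (m + K + k)%N; rewrite exprS; apply: wfil_mul => //.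
      by rewrite xE; apply: wfil_mull.
    by exists (n + j)%N; apply: wfil_mull.
have [N [N0 sN]] : exists N, (0 < N)%N /\ forall z, z \in s -> wfil K N z.
  elim: s => [|z s [N [N0 IH]]]; first by exists 1%N.
  have [n zn] := tW z; exists (maxn n N); split; first by rewrite leq_max N0 orbT.
  move=> t; rewrite inE => /orP[/eqP->|/IH tN].
    by apply: wfil_mono zn; rewrite leq_maxl.
  by apply: wfil_mono tN; rewrite leq_maxr.
exists N; split => // n.
have [M MP <-] := wfil_in_span (n * N) K0.
apply: dim_span_le => z /powVP[w [sw ws ->]]; apply: MP.
rewrite -sw; elim: w {sw} ws => [|u w IH] ws; first by rewrite big_nil; apply/wfil_gen/gen_one.
have /IH {}IH : {subset w <= 1 :: s} by move=> t tw; apply: ws; rewrite inE tw orbT.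
rewrite big_cons /= mulSn; have := ws u; rewrite !inE eqxx => /(_ isT)/orP[/eqP->|/sN uN].
  by rewrite mul1r; apply: wfil_mono IH; rewrite leq_addl.
exact: wfil_mul.
Qed.

End Upper.

(** * Limits superior of logarithmic growth rates *)

Section Growth.
Variable K : realType.
Implicit Types (u : (\bar K)^nat) (x y : \bar K) (M : K).

Lemma lee_reals x y : (forall M, (y < M%:E)%E -> (x <= M%:E)%E) -> (x <= y)%E.
Proof.
case: y => [r| |] h; last 2 first.
- by rewrite leey.
- case: x h => [r| |] h //; last by have := h 0 (ltNyr 0).
  by have := h (r - 1) (ltNyr _); rewrite lee_fin => ?; exfalso; lra.
apply/lee_addgt0Pr => e e0; rewrite -EFinD; apply: h.
by rewrite lte_fin ltrDl.
Qed.

Lemma limn_esup_leP u M : (limn_esup u < M%:E)%E ->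
  exists n0, forall n, (n0 <= n)%N -> (u n <= M%:E)%E.
Proof.
move=> /ereal_inf_ltP [_ [V [n0 _ n0V] <-] VM]; exists n0 => n n0n.
by apply: le_trans (ltW VM); apply: ereal_sup_ubound; exists n => //; apply: n0V.
Qed.

Lemma limn_esup_le u M n0 : (forall n, (n0 <= n)%N -> (u n <= M%:E)%E) ->
  (limn_esup u <= M%:E)%E.
Proof.
move=> h; apply: ge_ereal_inf.
exists (ereal_sup [set u n | n in [set n | (n0 <= n)%N]]%classic).
  by exists [set n | (n0 <= n)%N]%classic => //; exists n0.
by apply: ge_ereal_sup => _ [n /= n0n <-]; apply: h.
Qed.

(** If [d2] is eventually at most the power [M] of its index, then at [n * N] its logarithm is at
    most [M * ln n] plus the constant [M * ln N], and constants vanish after division by [ln n]. *)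
Lemma growth_le (d1 d2 : nat -> nat) (k C : K) N : (0 < N)%N ->
  (forall n, (2 <= n)%N ->
     ln (d1 n)%:R + k * ln n%:R <= ln (d2 (n * N)%N)%:R + C) ->
  (limn_esup (fun n => (ln (d1 n)%:R / ln (n%:R : K))%:E) + k%:E <=
   limn_esup (fun n => (ln (d2 n)%:R / ln (n%:R : K))%:E))%E.
Proof.
move=> N0 h; apply: lee_reals => M /limn_esup_leP [n0 n0M].
rewrite -leeBrDr // -EFinB; apply/lee_addgt0Pr => e e0; rewrite -EFinD.
set C' := `|M * ln N%:R + C|.
(* From this threshold on, [C'] is at most [e * ln n]. *)
have [n1 _ n1e] := nbhs_infty_ger (expR (C' / e)).
apply: (@limn_esup_le _ _ (maxn 2 (maxn n0 n1))) => n.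
rewrite !geq_max => /and3P[n2 n0n n1n]; rewrite lee_fin.
have lnn : 0 < ln (n%:R : K) by rewrite ln_gt0 // ltr1n.
have n_pos : (n%:R : K) \is Num.pos by rewrite posrE ltr0n; case: n n2 {n0n n1n lnn}.
have N_pos : (N%:R : K) \is Num.pos by rewrite posrE ltr0n.
have lnN : 0 <= ln (N%:R : K) by rewrite ln_ge0 // ler1n.
have lnnN : 0 < ln ((n * N)%:R : K) by rewrite natrM lnM // ltr_pwDl.
have C'n : C' <= e * ln (n%:R : K).
  rewrite -ler_pdivrMl // mulrC -[X in X <= _]expRK ler_ln ?posrE ?expR_gt0 //.
  exact: n1e.
have := n0M (n * N)%N (leq_trans n0n (leq_pmulr _ N0)).
rewrite lee_fin ler_pdivrMr // => h2.
have := le_trans (h n n2) (lerD h2 (lexx C)).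
rewrite natrM lnM // ler_pdivrMr // => h3.
have : M * ln N%:R + C <= C' by apply: ler_norm.
by move=> h4; rewrite !mulrDl mulNr; rewrite mulrDr in h3; lra.
Qed.

End Growth.


(** * Coefficients of powers of x, and the lower growth bound *)

Section Coefficients.
Variables (F : fieldType) (A : algType F) (R : {pred A}) (x : A).
Hypothesis Rsub : is_subalgebra R.
Hypothesis span_x : forall t : A, exists rs : seq A, {subset rs <= R} /\
  t = \sum_(i < size rs) rs`_i * x ^+ i.
Hypothesis free_x : forall rs : seq A, {subset rs <= R} ->
  \sum_(i < size rs) rs`_i * x ^+ i = 0 -> forall i, rs`_i = 0.

Lemma sum_nth_widen (rs : seq A) n : (size rs <= n)%N ->
  \sum_(i < size rs) rs`_i * x ^+ i = \sum_(i < n) rs`_i * x ^+ i.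
Proof.
move=> le_n; rewrite (big_ord_widen n (fun i => rs`_i * x ^+ i)) // big_mkcond /=.
by apply: eq_bigr => i _; case: ltnP => // h; rewrite nth_default // mul0r.
Qed.

Lemma free_x_eq (rs ts : seq A) : {subset rs <= R} -> {subset ts <= R} ->
  \sum_(i < size rs) rs`_i * x ^+ i = \sum_(i < size ts) ts`_i * x ^+ i ->
  forall i, rs`_i = ts`_i.
Proof.
move=> rsR tsR; set n := maxn (size rs) (size ts).
rewrite (@sum_nth_widen rs n) ?leq_maxl // (@sum_nth_widen ts n) ?leq_maxr //.
move=> /eqP; rewrite -subr_eq0 -sumrB => /eqP h i.
have [ni|ni] := leqP n i.
  by rewrite !nth_default // (leq_trans _ ni) ?leq_maxl ?leq_maxr.
apply/eqP; rewrite -subr_eq0; apply/eqP.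
have := @free_x (mkseq (fun i => rs`_i - ts`_i) n) _ _ i.
rewrite nth_mkseq //; apply.
  move=> z /mapP[j _ ->]; apply: (subalgD Rsub); first exact: subalg_nth.
  by apply: (subalgN Rsub); apply: subalg_nth.
rewrite size_mkseq -[RHS]h; apply: eq_bigr => j _.
by rewrite nth_mkseq // mulrBl.
Qed.

(** Choice picks a coefficient list for each element; freeness makes its entries independent of the
    choice, hence linear. These maps later serve as test functions on the legs of tensors. *)
Lemma exists_coef : exists c : nat -> A -> A,
  [/\ forall i t, c i t \in R, forall i, lin (c i) &
      forall i j r, r \in R -> c i (r * x ^+ j) = if i == j then r else 0].
Proof.
have /choice [cs csP] := span_x.
have csR t : {subset cs t <= R} by case: (csP t).
have csE rs t : {subset rs <= R} -> t = \sum_(i < size rs) rs`_i * x ^+ i ->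
    forall i, (cs t)`_i = rs`_i.
  by move=> rsR tE; case: (csP t) => ctR; rewrite {1}tE => /free_x_eq h i; rewrite h.
exists (fun i t => (cs t)`_i); split=> [i t|i k t u|i j r rR].
- exact: (subalg_nth Rsub).
- set n := maxn (size (cs t)) (size (cs u)).
  rewrite (@csE (mkseq (fun i => k *: (cs t)`_i + (cs u)`_i) n)).
  + have [ni|ni] := leqP n i; last by rewrite nth_mkseq.
    rewrite !nth_default ?size_mkseq ?(leq_trans _ ni) ?leq_maxl ?leq_maxr //.
    by rewrite scaler0 addr0.
  + move=> z /mapP[j _ ->]; apply: (subalgD Rsub); [apply: (subalgZ Rsub)|];
    by apply: (subalg_nth Rsub).
  + rewrite size_mkseq {1}(proj2 (csP t)) {1}(proj2 (csP u)).
    rewrite (@sum_nth_widen (cs t) n) ?leq_maxl // (@sum_nth_widen (cs u) n) ?leq_maxr //.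
    rewrite scaler_sumr -big_split /=; apply: eq_bigr => j _.
    by rewrite nth_mkseq // mulrDl scalerAl.
- rewrite (@csE (rcons (nseq j 0) r)).
  + rewrite nth_rcons size_nseq nth_nseq if_same.
    by case: ltngtP.
  + by move=> z; rewrite mem_rcons inE => /orP[/eqP->//|/nseqP[-> _]]; apply: subalg0.
  + rewrite size_rcons size_nseq big_ord_recr /= nth_rcons size_nseq ltnn eqxx.
    rewrite big1 ?add0r // => m _; rewrite nth_rcons size_nseq ltn_ord.
    by rewrite nth_nseq ltn_ord mul0r.
Qed.

Lemma lin_indep_cat (L M : seq A) : lin_indep L -> lin_indep M ->
  (forall u, in_span L u -> in_span M u -> u = 0) -> lin_indep (L ++ M).
Proof.
move=> Li Mi LM c; rewrite size_cat => sc.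
rewrite big_split_ord /=.
under eq_bigr do rewrite nth_cat ltn_ord.
under [X in _ + X]eq_bigr do
  rewrite nth_cat ltnNge leq_addr /= addKn -nth_drop.
move=> /eqP; rewrite addr_eq0 => /eqP h.
have uL : in_span L (\sum_(i < size L) c`_i *: L`_i) by exists c.
have uM : in_span M (\sum_(i < size L) c`_i *: L`_i).
  rewrite h -scaleN1r; apply: in_spanZ; by exists (drop (size L) c).
have u0 := LM _ uL uM; move: h; rewrite u0 => /esym/eqP; rewrite oppr_eq0 => /eqP h.
have := Li (take (size L) c); rewrite size_takel ?sc ?leq_addr // => /(_ erefl).
under eq_bigr do rewrite nth_take //.
move=> /(_ u0) cL.
have := Mi (drop (size L) c); rewrite size_drop sc addKn => /(_ erefl h) cM i.
have [iL|iL] := ltnP i (size L); first by rewrite -(nth_take 0 iL) cL.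
by rewrite -(subnKC iL) -nth_drop cM.
Qed.

(** [c n] kills the blocks of smaller exponent and recovers the coefficient on the block of
    [x ^+ n], so each new block is independent and meets the previous span trivially. *)
Lemma lin_indep_mulX (B : seq A) n : {subset B <= R} -> lin_indep B ->
  lin_indep [seq p * x ^+ i | i <- iota 0 n, p <- B].
Proof.
move=> BR Bi; have [c [_ cl cE]] := exists_coef.
have spanX j z : in_span [seq p * x ^+ j | p <- B] z ->
    exists d : seq F, z = (\sum_(i < size B) d`_i *: B`_i) * x ^+ j.
  move=> [d ->]; exists d; rewrite size_map mulr_suml; apply: eq_bigr => i _.
  by rewrite (nth_map 0) // scalerAl.
have sumR (d : seq F) : \sum_(i < size B) d`_i *: B`_i \in R.
  by apply: (subalg_sum Rsub) => i _; apply/(subalgZ Rsub)/BR/mem_nth.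
elim: n => [|n IH]; first by case=> // _ _ i; rewrite nth_nil.
rewrite -addn1 iotaD map_cat flatten_cat /= cats0 add0n; apply: lin_indep_cat => //.
- move=> d; rewrite size_map => sd h; apply: Bi => //.
  have := cE n n _ (sumR d); rewrite eqxx => <-.
  rewrite mulr_suml -[RHS](lin0 (cl n)); congr (c n _).
  rewrite -[RHS]h; apply: eq_bigr => i _.
  by rewrite (nth_map 0) // scalerAl.
- move=> u uL /spanX [d uE]; suff d0 : \sum_(i < size B) d`_i *: B`_i = 0.
    by rewrite uE d0 mul0r.
  have := cE n n _ (sumR d); rewrite eqxx -uE => <-.
  have [e ->] := uL; rewrite lin_bigsum // big1 // => i _; rewrite linZ //.
  have /allpairsP [[j p] [/= jn pB ->]] := mem_nth 0 (ltn_ord i).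
  rewrite cE ?BR //; move: jn; rewrite mem_iota add0n => /ltn_eqF; rewrite eq_sym => ->.
  by rewrite scaler0.
Qed.

Lemma dim_powV_lower (s : seq A) n : {subset s <= R} ->
  (n.+1 * Defs.dim_span (powV s n) <= Defs.dim_span (powV (x :: s) (n * 2)))%N.
Proof.
move=> sR; have [B [Bs Bi <- _]] := exists_basis (powV s n).
rewrite -[n.+1](size_iota 0) -(size_allpairs (fun i p => p * x ^+ i)).
apply: dim_span_ge.
  by apply: lin_indep_mulX => // p /Bs; apply: subalg_powV.
move=> u /allpairsP [[j p] [/= jn /Bs/powVP[w [sw ws ->]] ->]].
apply: in_span_mem.
have -> : (\prod_(v <- w) v) * x ^+ j = \prod_(v <- w ++ nseq j x) v.
  by rewrite big_cat big_nseq iter_mulr mulr1.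
apply: powV_prod.
  rewrite size_cat sw size_nseq muln2 -addnn leq_add2l.
  by move: jn; rewrite -[0%N :: _]/(iota 0 n.+1) mem_iota add0n ltnS.
move=> z; rewrite mem_cat => /orP[/ws|/nseqP[-> _]]; last by rewrite !inE eqxx orbT.
by rewrite !inE => /orP[->//|->]; rewrite !orbT.
Qed.

End Coefficients.

(** The span contains [1]. Positivity lets products of dimensions become sums of logarithms. *)
Lemma dim_powV_gt0 (F : fieldType) (A : algType F) (s : seq A) n :
  (0 < Defs.dim_span (powV s n))%N.
Proof.
apply: (@dim_span_ge _ _ [:: 1]) => [[//|k [|//]] _|u].
  rewrite big_ord1 /= => /eqP; rewrite scaler_eq0 oner_eq0 orbF => /eqP k0 i.
  by case: i => [|[|i]].
rewrite inE => /eqP->; apply: in_span_mem.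
have -> : 1 = \prod_(u <- [::]) u :> A by rewrite big_nil.
exact: powV_prod.
Qed.

(** * From dimension estimates to GK dimension *)

Section GKdimExtension.
Variables (F : fieldType) (A : algType F) (R : {pred A}).

Lemma GKdim_lower (x : A) : is_subalgebra R ->
  (forall t : A, exists rs : seq A, {subset rs <= R} /\
    t = \sum_(i < size rs) rs`_i * x ^+ i) ->
  (forall rs : seq A, {subset rs <= R} ->
    \sum_(i < size rs) rs`_i * x ^+ i = 0 -> forall i, rs`_i = 0) ->
  (GKdim R + 1%:E <= GKdim (fun _ : A => true))%E.
Proof.
move=> Rsub span_x free_x; rewrite -leeBrDr //; apply: ge_ereal_sup => _ [s sR <-].
rewrite leeBrDr //; apply: le_trans (ereal_sup_ubound _); last first.
  by exists (x :: s).
(* The factor [n.+1] supplies the summand [ln n]; the doubled word length is the rescaling by 2. *)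
apply: (@growth_le _ _ _ 1 0 2) => // n n2; rewrite addr0 mul1r.
have n0 : (0 < n)%N by apply: ltn_trans n2.
have ds := dim_powV_gt0 s n.
rewrite -lnM ?posrE ?ltr0n // -natrM ler_ln ?posrE ?ltr0n ?muln_gt0 ?ds ?n0 //.
  rewrite ler_nat; apply: leq_trans (dim_powV_lower Rsub span_x free_x n sR).
  by rewrite mulnC leq_mul2r leqnSn orbT.
exact: dim_powV_gt0.
Qed.

Lemma GKdim_upper (L : seq A) : {subset L <= R} ->
  (forall s : seq A, exists N, (0 < N)%N /\ forall n,
    (Defs.dim_span (powV s n) <= (n * N).+1 * Defs.dim_span (powV L (n * N)))%N) ->
  (GKdim (fun _ : A => true) <= GKdim R + 1%:E)%E.
Proof.
move=> LR upper; apply: ge_ereal_sup => _ [s _ <-]; have [N [N0 sN]] := upper s.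
rewrite -leeBlDr //; apply: le_trans (ereal_sup_ubound _); last by exists L.
(* For positive [n], [(n * N).+1 <= n * N.+1] splits the linear factor into [ln n] and the constant
   [ln N.+1]. *)
apply: (@growth_le _ _ _ (-1) (ln N.+1%:R) N) => // n n2; rewrite mulN1r.
have n0 : (0 < n)%N by apply: ltn_trans n2.
have dL := dim_powV_gt0 L (n * N).
rewrite lerBlDr -addrA -lnM ?posrE ?ltr0n // -natrM.
rewrite -lnM ?posrE ?ltr0n ?muln_gt0 // -natrM.
rewrite ler_ln ?posrE ?ltr0n ?muln_gt0 ?dim_powV_gt0 ?n0 //.
rewrite ler_nat; apply: leq_trans (sN n) _.
by rewrite mulnC leq_mul2l mulSn mulnC -addn1 addnC leq_add2r n0 orbT.
Qed.

End GKdimExtension.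

(** * Multilinear maps and Sweedler sums *)

Section LinearClosure.
Variables (F : fieldType) (U V W : lmodType F).

Lemma lin_id : lin (fun u : U => u). Proof. by []. Qed.
Lemma lin_comp (g : V -> W) (f : U -> V) : lin g -> lin f -> lin (fun u => g (f u)).
Proof. by move=> gl fl k u v; rewrite fl gl. Qed.
Lemma lin_add (f g : U -> V) : lin f -> lin g -> lin (fun u => f u + g u).
Proof. by move=> fl gl k u v; rewrite fl gl scalerDr addrACA. Qed.
Lemma lin_scaler (k : F) (f : U -> V) : lin f -> lin (fun u => k *: f u).
Proof. by move=> fl c u v; rewrite fl scalerDr !scalerA mulrC. Qed.
Lemma lin_scalel (v : V) (f : U -> F^o) : lin f -> lin (fun u => (f u : F) *: v).
Proof. by move=> fl c u w; rewrite fl scalerDl scalerA. Qed.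
Lemma lin_sum (I : Type) (r : seq I) (f : U -> I -> V) :
  (forall i, lin (f^~ i)) -> lin (fun u => \sum_(i <- r) f u i).
Proof.
by move=> fl k u v; rewrite scaler_sumr -big_split; apply: eq_bigr => i _; apply: fl.
Qed.

End LinearClosure.

Section LinearClosureAlg.
Variables (F : fieldType) (U : lmodType F) (A : algType F).

Lemma lin_mull (z : A) (f : U -> A) : lin f -> lin (fun u => z * f u).
Proof. by move=> fl k u v; rewrite fl mulrDr scalerAr. Qed.
Lemma lin_mulr (z : A) (f : U -> A) : lin f -> lin (fun u => f u * z).
Proof. by move=> fl k u v; rewrite fl mulrDl scalerAl. Qed.

End LinearClosureAlg.

Section Sweedler.
Variables (F : fieldType) (T : algType F) (X : tensor_data T).
Hypothesis HX : is_tensor_data X.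

Variable rep : TT X -> seq (T * T).
Hypothesis repE : forall z, z = \sum_(p <- rep z) t2 X p.1 p.2.

(** Sweedler notation relative to a chosen representation of [z]. The value is free of the choice
    once [f] factors through a linear map on the tensor product, as every bilinear [f] does. *)
Definition tsum (Y : lmodType F) (f : T -> T -> Y) (z : TT X) : Y :=
  \sum_(p <- rep z) f p.1 p.2.

Lemma t2_bilin : bilin (t2 X). Proof. by case: HX. Qed.

Lemma sum2_univ (Y : lmodType F) (f : T -> T -> Y) (g : TT X -> Y) z :
  lin g -> (forall p q, g (t2 X p q) = f p q) -> tsum f z = g z.
Proof.
by move=> gl gE; rewrite [in RHS](repE z) lin_bigsum //; apply: eq_bigr => p _.
Qed.

Lemma sum2_lin (Y : lmodType F) (f : T -> T -> Y) : bilin f -> lin (tsum f).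
Proof.
move=> fb; have [_ [h _] _ _ _] := HX; have [g [gl gE]] := h _ _ fb.
by move=> k u v; rewrite !(@sum2_univ _ _ g) // gl.
Qed.

Lemma sum2_t2 (Y : lmodType F) (f : T -> T -> Y) p q : bilin f ->
  tsum f (t2 X p q) = f p q.
Proof.
move=> fb; have [_ [h _] _ _ _] := HX; have [g [gl gE]] := h _ _ fb.
by rewrite (@sum2_univ _ _ g).
Qed.

Lemma eq_sum2 (Y : lmodType F) (f g : T -> T -> Y) z :
  (forall p q, f p q = g p q) -> tsum f z = tsum g z.
Proof. by move=> fg; apply: eq_bigr. Qed.

Lemma sum2_comp (Y Z : lmodType F) (h : Y -> Z) (f : T -> T -> Y) z : lin h ->
  tsum (fun p q => h (f p q)) z = h (tsum f z).
Proof. by move=> hl; rewrite [in RHS]/tsum lin_bigsum. Qed.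

Lemma sum2_0 (Y : lmodType F) (f : T -> T -> Y) z :
  (forall p q, f p q = 0) -> tsum f z = 0.
Proof. by move=> f0; apply: big1. Qed.

Lemma exchange_sum2 (Y : lmodType F) (f : T -> T -> T -> T -> Y) z z' :
  tsum (fun p q => tsum (f p q) z') z =
  tsum (fun p' q' => tsum (fun p q => f p q p' q') z) z'.
Proof. exact: exchange_big. Qed.

Lemma lin_sum2 (U Y : lmodType F) (f : U -> T -> T -> Y) z :
  (forall p q, lin (fun u => f u p q)) -> lin (fun u => tsum (f u) z).
Proof. by move=> fl; apply: lin_sum => p; apply: fl. Qed.

Lemma lin_sum2z (U Y : lmodType F) (f : T -> T -> Y) (g : U -> TT X) :
  bilin f -> lin g -> lin (fun u => tsum f (g u)).
Proof. by move=> fb gl; apply: lin_comp (sum2_lin fb) gl. Qed.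

Lemma t2M p q p' q' : t2 X p q * t2 X p' q' = t2 X (p * p') (q * q').
Proof. by case: HX => _ _ []. Qed.

Lemma sum2M (Y : lmodType F) (f : T -> T -> Y) z z' : bilin f ->
  tsum f (z * z') = tsum (fun p q => tsum (fun p' q' => f (p * p') (q * q')) z') z.
Proof.
move=> fb; have fl := sum2_lin fb.
rewrite {1}(repE z) mulr_suml lin_bigsum //; apply: eq_bigr => p _.
rewrite {1}(repE z') mulr_sumr lin_bigsum //; apply: eq_bigr => p' _.
by rewrite t2M sum2_t2.
Qed.

End Sweedler.

(** Settles the multilinearity side conditions of the Sweedler computations by the syntactic shape
    of the map. *)
Ltac lint := cbv beta; lazymatch goal with
| |- bilin _ => split; intro; lint
| |- trilin _ => split; [|split]; intros ? ?; lint
| |- lin (fun u => u) => apply lin_id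
| |- lin (fun u => _ + _) => apply lin_add; lint
| |- lin (fun u => _ *: _) => first [apply lin_scaler | apply lin_scalel]; lint
| |- lin (fun u => tsum _ _ _) =>
    first [apply lin_sum2; intros | apply lin_sum2z]; lint
| |- lin (fun u => _ * _) => first [apply lin_mull | apply lin_mulr]; lint
| |- lin (GRing.mul _) => exact (lin_mull _ (@lin_id _ _))
| |- @lin _ ?U ?W (fun u => ?h (@?f u)) => refine (@lin_comp _ U _ W h f _ _); [try by [] | lint]
| |- _ => try by []
end.

(** * Hopf algebra identities in Sweedler form *)

Section HopfSums.
Variables (F : fieldType) (T : algType F) (X : tensor_data T).
Variables (Delta : T -> TT X) (eps : T -> F) (S : T -> T).
Hypothesis hopf : is_hopf Delta eps S.
Variable rep : TT X -> seq (T * T).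
Hypothesis repE : forall z, z = \sum_(p <- rep z) t2 X p.1 p.2.
Local Notation sum2 := (tsum rep).

Lemma hopf_tensor : is_tensor_data X. Proof. by case: hopf => -[]. Qed.
Lemma Delta_lin : lin Delta. Proof. by case: hopf => -[_ []]. Qed.
Lemma DeltaM p q : Delta (p * q) = Delta p * Delta q.
Proof. by case: hopf => -[_ []]. Qed.
Lemma eps_lin : lin (fun h => (eps h : F^o)). Proof. by case: hopf => _ []. Qed.
Lemma epsM p q : eps (p * q) = eps p * eps q. Proof. by case: hopf => _ []. Qed.
Lemma eps1 : eps 1 = 1. Proof. by case: hopf => _ []. Qed.

Let tb := t2_bilin hopf_tensor.
Let Dl := Delta_lin.
Let el := eps_lin.

(** The axioms do not state linearity of [S]; it is inherited from the contraction [A1], since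
    [S z = A1 (t2 X z 1)]. *)
Lemma S_lin : lin S.
Proof.
case: hopf => _ _ _ [A1 [A2 [A1l A1E _ _ _]]] _ k p q.
have SE z : S z = A1 (t2 X z 1) by rewrite A1E mulr1.
by rewrite !SE -A1l (proj1 tb 1).
Qed.
Let Sl := S_lin.

Lemma counitl h : sum2 (fun p q => eps p *: q) (Delta h) = h.
Proof.
case: hopf => _ _ [_ [E1 [E2 [E1l E1E _ _ hE]]]] _ _.
by rewrite (sum2_univ repE _ E1l E1E); case: (hE h).
Qed.

Lemma counitr h : sum2 (fun p q => eps q *: p) (Delta h) = h.
Proof.
case: hopf => _ _ [_ [E1 [E2 [_ _ E2l E2E hE]]]] _ _.
by rewrite (sum2_univ repE _ E2l E2E); case: (hE h).
Qed.

Lemma antipodel h : sum2 (fun p q => S p * q) (Delta h) = eps h *: 1.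
Proof.
case: hopf => _ _ _ [A1 [A2 [A1l A1E _ _ hA]]] _.
by rewrite (sum2_univ repE _ A1l A1E); case: (hA h).
Qed.

Lemma antipoder h : sum2 (fun p q => p * S q) (Delta h) = eps h *: 1.
Proof.
case: hopf => _ _ _ [A1 [A2 [_ _ A2l A2E hA]]] _.
by rewrite (sum2_univ repE _ A2l A2E); case: (hA h).
Qed.

(** A trilinear [f] factors through [TTT X], so the equality of [D1] and [D2] on [Delta h] can be
    read under [f]. *)
Lemma coassoc (Y : lmodType F) (f : T -> T -> T -> Y) h : trilin f ->
  sum2 (fun p q => sum2 (fun p1 p2 => f p1 p2 q) (Delta p)) (Delta h) =
  sum2 (fun p q => sum2 (fun q1 q2 => f p q1 q2) (Delta q)) (Delta h).
Proof.
move=> ft; have [_ _ _ _ [/(_ _ _ ft) [g [gl gE]] _]] := hopf_tensor.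
case: hopf => _ _ [[M1 [M2 [D1 [D2 [[M1l M1E] [M2l M2E] [D1l D1E] [D2l D2E] DE]]]]] _] _ _.
rewrite (sum2_univ repE (g := fun z => g (D1 z))) ?DE.
- symmetry; apply: (sum2_univ repE (g := fun z => g (D2 z))).
    exact: lin_comp gl D2l.
  move=> p q; rewrite D2E; symmetry.
  apply: (sum2_univ repE (g := fun z => g (M2 p z))) => [|q1 q2].
    exact: lin_comp gl (M2l p).
  by rewrite M2E gE.
- exact: lin_comp gl D1l.
- move=> p q; rewrite D1E; symmetry.
  apply: (sum2_univ repE (g := fun z => g (M1 z q))) => [|q1 q2].
    exact: lin_comp gl (M1l q).
  by rewrite M1E gE.
Qed.

(* Both sides arise from [S(h1 k1) h2 k2 S(k3) S(h3)] by contracting in two orders. *)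
Lemma antipodeM h k : S (h * k) = S k * S h.
Proof.
pose G h1 h2 h3 k1 k2 k3 := S (h1 * k1) * (h2 * k2) * S k3 * S h3.
transitivity (sum2 (fun h' h3 => sum2 (fun h1 h2 => sum2 (fun k' k3 =>
  sum2 (fun k1 k2 => G h1 h2 h3 k1 k2 k3) (Delta k')) (Delta k)) (Delta h')) (Delta h)).
- transitivity (sum2 (fun h' h3 => sum2 (fun h1 h2 =>
    S (h1 * k) * (h2 * S h3)) (Delta h')) (Delta h)).
    rewrite (coassoc (f := fun h1 h2 h3 => S (h1 * k) * (h2 * S h3))); last by lint.
    rewrite -{1}(counitr h) -[LHS](sum2_comp rep _ _ (h := fun z => S (z * k))); last by lint.
    apply: eq_sum2 => p q; rewrite -scalerAl linZ //.
    rewrite (sum2_comp rep _ _ (h := fun z => S (p * k) * z)); last by lint.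
    by rewrite antipoder -scalerAr mulr1.
  apply: eq_sum2 => h' h3; apply: eq_sum2 => h1 h2.
  rewrite (coassoc (f := fun k1 k2 k3 => G h1 h2 h3 k1 k2 k3)); last by rewrite /G; lint.
  rewrite -{1}(counitr k).
  rewrite -[LHS](sum2_comp rep _ _ (h := fun z => S (h1 * z) * (h2 * S h3))); last by lint.
  apply: eq_sum2 => p q.
  transitivity (sum2 (fun k2 k3 => S (h1 * p) * h2 * (k2 * S k3) * S h3) (Delta q)).
    rewrite (sum2_comp rep _ _ (h := fun z => S (h1 * p) * h2 * z * S h3)); last by lint.
    by rewrite antipoder -scalerAr linZ // -!scalerAr -!scalerAl mulr1 mulrA.
  by apply: eq_sum2 => k2 k3; rewrite /G !mulrA.
- transitivity (sum2 (fun h' h3 => sum2 (fun k' k3 =>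
    eps h' *: (eps k' *: (S k3 * S h3))) (Delta k)) (Delta h)).
    apply: eq_sum2 => h' h3; rewrite exchange_sum2; apply: eq_sum2 => k' k3.
    rewrite scalerA -epsM.
    transitivity ((eps (h' * k') *: 1) * S k3 * S h3); last first.
      by rewrite -!scalerAl mul1r.
    rewrite -antipodel -mulrA.
    rewrite -[RHS](sum2_comp rep _ _ (h := fun z => z * (S k3 * S h3))); last by lint.
    rewrite DeltaM sum2M //; last by lint.
    + by apply: eq_sum2 => h1 h2; apply: eq_sum2 => k1 k2; rewrite /G !mulrA.
    + exact: hopf_tensor.
  rewrite -[in RHS](counitl h) -[RHS](sum2_comp rep _ _ (h := fun z => S k * S z)); last by lint.
  apply: eq_sum2 => p q; rewrite linZ // -scalerAr.
  rewrite (sum2_comp rep _ _ (h := fun z => eps p *: z)); last by lint.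
  congr (_ *: _); rewrite -[in RHS](counitl k).
  rewrite -[RHS](sum2_comp rep _ _ (h := fun z => S z * S q)); last by lint.
  by apply: eq_sum2 => p' q'; rewrite linZ // -scalerAl.
Qed.

(** Apply [eps] to the left antipode identity and absorb the second leg by the counit. *)
Lemma eps_antipode h : eps (S h) = eps h.
Proof.
have : (eps (eps h *: 1) : F^o) = eps h by rewrite (linZ _ _ el) eps1 /GRing.scale /= mulr1.
rewrite -antipodel -[LHS](sum2_comp rep _ _ el) => <-.
rewrite -{1}(counitr h) -[LHS](sum2_comp rep _ _ (h := fun z => eps (S z) : F^o)); last by lint.
by apply: (@eq_sum2 _ _ _ _ F^o) => p q; rewrite epsM mulrC (linZ _ _ Sl) (linZ _ _ el).
Qed.

End HopfSums.

(** * The Hopf axioms evaluated at x *)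

Section HopfOre.
Variables (F : fieldType) (T : algType F) (X : tensor_data T).
Variables (Delta : T -> TT X) (eps : T -> F) (S : T -> T).
Hypothesis hopf : is_hopf Delta eps S.
Variable rep : TT X -> seq (T * T).
Hypothesis repE : forall z, z = \sum_(p <- rep z) t2 X p.1 p.2.
Local Notation sum2 := (tsum rep).

Variable R : {pred T}.
Hypothesis Rsub : is_subalgebra R.
Hypothesis repR : forall z, in_tensor2 R z ->
  forall p, p \in rep z -> p.1 \in R /\ p.2 \in R.
Hypothesis DeltaR : forall r, r \in R -> in_tensor2 R (Delta r).
Hypothesis SR : forall r, r \in R -> S r \in R.

Variables (sigma delta : T -> T) (x : T).
Hypothesis sigma_aut : is_automorphism_on R sigma.
Hypothesis delta_der : is_sigma_derivation_on R sigma delta.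
Hypothesis xr : forall r, r \in R -> x * r = sigma r * x + delta r.

Variable c : nat -> T -> T.
Hypothesis cR : forall i t, c i t \in R.
Hypothesis cl : forall i, lin (c i).
Hypothesis cE : forall i j r, r \in R -> c i (r * x ^+ j) = if i == j then r else 0.

Variables (a b : T) (v w : TT X) (alpha beta alpha' : T).
Hypotheses (aR : a \in R) (bR : b \in R) (vR : in_tensor2 R v) (wR : in_tensor2 R w).
Hypothesis Dx : Delta x = t2 X a x + t2 X x b + v * t2 X x x + w.
Hypotheses (alphaR : alpha \in R) (betaR : beta \in R).
Hypothesis a'a : alpha' * alpha = 1.
Hypothesis Sx : S x = alpha * x + beta.

Let HX := hopf_tensor hopf.
Let Dl := Delta_lin hopf.
Let el := eps_lin hopf.
Let Sl := S_lin hopf.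
Let R0 := subalg0 Rsub.
Let R1 := subalg1 Rsub.
Let RM := subalgM Rsub.
Let RD := subalgD Rsub.
Let RZ := subalgZ Rsub.
Let sigmaR r : r \in R -> sigma r \in R. Proof. by case: sigma_aut => h *; apply: h. Qed.
Let deltaR r : r \in R -> delta r \in R. Proof. by case: delta_der => h *; apply: h. Qed.
Let sigma1 : sigma 1 = 1. Proof. by case: sigma_aut. Qed.
Let sigmaM p q : p \in R -> q \in R -> sigma (p * q) = sigma p * sigma q.
Proof. by case: sigma_aut => _ _ [_ h] _ _; apply: h. Qed.
Let sigmaL k p q : p \in R -> q \in R -> sigma (k *: p + q) = k *: sigma p + sigma q.
Proof. by case: sigma_aut => _ _ _ _ h; apply: h. Qed.

(** [rep] keeps both legs in [R] for tensors coming from [R], so facts about [sigma], [delta] and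
    [c] that hold only on [R] may be used under the sum. *)
Lemma eq_sum2R (Y : lmodType F) (f g : T -> T -> Y) z : in_tensor2 R z ->
  (forall p q, p \in R -> q \in R -> f p q = g p q) -> sum2 f z = sum2 g z.
Proof.
move=> zR fg; rewrite /tsum big_seq [RHS]big_seq; apply: eq_bigr => p /(repR zR)[].
exact: fg.
Qed.

Lemma sum2R_0 (Y : lmodType F) (f : T -> T -> Y) z : in_tensor2 R z ->
  (forall p q, p \in R -> q \in R -> f p q = 0) -> sum2 f z = 0.
Proof. by move=> zR /(eq_sum2R zR)->; apply: sum2_0. Qed.

Lemma sum2_R f z : in_tensor2 R z ->
  (forall p q, p \in R -> q \in R -> f p q \in R) -> sum2 f z \in R.
Proof.
move=> zR fR; rewrite /tsum big_seq; apply: (subalg_sum Rsub) => p /(repR zR)[].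
exact: fR.
Qed.

Lemma c0R r : r \in R -> c 0 r = r.
Proof. by move=> rR; have := cE 0 0 rR; rewrite expr0 mulr1. Qed.
Lemma c1R r : r \in R -> c 1 r = 0.
Proof. by move=> rR; have := cE 1 0 rR; rewrite expr0 mulr1. Qed.
Lemma c0X r : r \in R -> c 0 (r * x) = 0.
Proof. by move=> rR; have := cE 0 1 rR; rewrite expr1. Qed.
Lemma c1X r : r \in R -> c 1 (r * x) = r.
Proof. by move=> rR; have := cE 1 1 rR; rewrite expr1. Qed.
Lemma c0x : c 0 x = 0. Proof. by rewrite -[x]mul1r c0X. Qed.
Lemma c1x : c 1 x = 1. Proof. by rewrite -[x]mul1r c1X. Qed.

Lemma bilin_mull (Y : lmodType F) (f : T -> T -> Y) p q : bilin f ->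
  bilin (fun p' q' => f (p * p') (q * q')).
Proof.
by move=> [f1 f2]; split=> [u k u1 u2|u k u1 u2]; rewrite mulrDr -scalerAr ?f1 ?f2.
Qed.

Lemma bilin_mulr (Y : lmodType F) (f : T -> T -> Y) p q : bilin f ->
  bilin (fun p' q' => f (p' * p) (q' * q)).
Proof.
by move=> [f1 f2]; split=> [u k u1 u2|u k u1 u2]; rewrite mulrDl -scalerAl ?f1 ?f2.
Qed.

Lemma sum2_Dx (Y : lmodType F) (f : T -> T -> Y) : bilin f ->
  sum2 f (Delta x) =
  f a x + f x b + sum2 (fun p q => f (p * x) (q * x)) v + sum2 f w.
Proof.
move=> fb; have fl := sum2_lin HX repE fb.
rewrite Dx !(linD _ _ fl) !(sum2_t2 HX repE) //; congr (_ + _ + _).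
rewrite (sum2M HX repE) //; apply: eq_sum2 => p q.
by rewrite (sum2_t2 HX repE) //; apply: bilin_mull.
Qed.

Lemma sum2_mulDx (Y : lmodType F) (f : T -> T -> Y) z : bilin f ->
  sum2 f (z * Delta x) = sum2 (fun p q =>
    f (p * a) (q * x) + f (p * x) (q * b) +
    sum2 (fun p' q' => f (p * (p' * x)) (q * (q' * x))) v +
    sum2 (fun p' q' => f (p * p') (q * q')) w) z.
Proof.
move=> fb; rewrite (sum2M HX repE) //; apply: eq_sum2 => p q.
by rewrite sum2_Dx //; apply: bilin_mull.
Qed.

Lemma sum2_Dxmul (Y : lmodType F) (f : T -> T -> Y) z : bilin f ->
  sum2 f (Delta x * z) = sum2 (fun p q =>
    f (a * p) (x * q) + f (x * p) (b * q) +
    sum2 (fun p' q' => f (p' * x * p) (q' * x * q)) v +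
    sum2 (fun p' q' => f (p' * p) (q' * q)) w) z.
Proof.
move=> fb; rewrite (sum2M HX repE) // exchange_sum2; apply: eq_sum2 => p q.
by rewrite sum2_Dx //; apply: bilin_mulr.
Qed.

Let m := sum2 (fun p q => S p * q) v.
Let u := sum2 (fun p q => eps p *: q) v.
Let W := sum2 (fun p q => S p * q) w.

Let mR : m \in R. Proof. by apply: sum2_R => // p q pR qR; apply: RM => //; apply: SR. Qed.
Let uR : u \in R. Proof. by apply: sum2_R => // p q pR qR; apply: RZ. Qed.
Let WR : W \in R. Proof. by apply: sum2_R => // p q pR qR; apply: RM => //; apply: SR. Qed.

Let epsZR (k : F) : k *: 1 \in R. Proof. exact: RZ. Qed.

Lemma quadratic_free r0 r1 r2 : r0 \in R -> r1 \in R -> r2 \in R ->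
  r2 * x ^+ 2 + r1 * x + r0 = 0 -> r2 = 0 /\ r1 = 0.
Proof.
move=> r0R r1R r2R h.
have h' i : c i (r2 * x ^+ 2 + r1 * x ^+ 1 + r0 * x ^+ 0) = 0.
  by rewrite expr1 expr0 mulr1 h lin0.
have := h' 2%N; have := h' 1%N.
by rewrite !(linD _ _ (cl _)) !cE //= !addr0 !add0r.
Qed.

Lemma sigma_inj r : r \in R -> sigma r = 0 -> r = 0.
Proof.
case: sigma_aut => _ _ [si _] _ _ rR r0; apply: si => //; rewrite r0.
by have := sigmaL (-1) R0 R0; rewrite !scaleN1r !addNr.
Qed.

(** As [S] reverses products, the quadratic term of [Delta x] becomes [S x * m * x], and the form of
    [S x] turns the antipode identity into a polynomial of degree 2 in [x]. Its leading coefficient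
    [alpha * sigma m] forces [m = 0]; the linear coefficient then reduces to the second claim. *)
Lemma antipode_at_x : m = 0 /\ S a + alpha * sigma b = 0.
Proof.
have := antipodel hopf repE x; rewrite sum2_Dx; last by lint.
have -> : sum2 (fun p q => S (p * x) * (q * x)) v = S x * m * x.
  rewrite -[RHS](sum2_comp rep _ _ (h := fun z => S x * z * x)); last by lint.
  by apply: eq_sum2 => p q; rewrite (antipodeM hopf repE) !mulrA.
rewrite -/W Sx => /eqP; rewrite -subr_eq0 => /eqP h.
have h2 : (alpha * sigma m) * x ^+ 2 +
  (S a + alpha * sigma b + alpha * delta m + beta * m) * x +
  (alpha * delta b + beta * b + W - eps x *: 1) = 0.
  have e1 : (alpha * x + beta) * b = alpha * sigma b * x + alpha * delta b + beta * b.
    by rewrite mulrDl -mulrA xr // mulrDr mulrA.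
  have e2 : (alpha * x + beta) * m * x =
      alpha * sigma m * x ^+ 2 + alpha * delta m * x + beta * m * x.
    by rewrite !mulrDl -(mulrA alpha) xr // mulrDr mulrDl expr2 !mulrA.
  rewrite -[RHS]h e1 e2 !mulrDl.
  by rewrite [LHS](AC (1*4*4) (2*(3*6*7)*(1*4*5)*8*9)).
have [] := quadratic_free _ _ _ h2.
- apply: RD; last by rewrite -scaleNr.
  by apply: RD => //; apply: RD; apply: RM => //; apply: deltaR.
- by do !apply: RD; rewrite ?RM ?SR ?sigmaR ?deltaR.
- by apply: RM => //; apply: sigmaR.
move=> sm0 s0; have m0 : m = 0.
  by apply: sigma_inj => //; rewrite -[LHS]mul1r -a'a -mulrA sm0 mulr0.
split=> //; move: s0; rewrite m0 mulr0 addr0.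
have -> : delta 0 = 0.
  by case: delta_der => _ dL _; have := dL (-1) _ _ R0 R0; rewrite !scaleN1r !addNr.
by rewrite mulr0 addr0.
Qed.


Let m0 : m = 0. Proof. by case: antipode_at_x. Qed.
Let SaE : S a = - (alpha * sigma b).
Proof. by case: antipode_at_x => _ /eqP; rewrite addr_eq0 => /eqP. Qed.

Lemma eps_eps_v : sum2 (fun p q => eps p * eps q : F^o) v = 0.
Proof.
have : (eps m : F^o) = 0 by rewrite m0 (lin0 el).
rewrite /m -[LHS](sum2_comp rep _ _ el) => <-.
by apply: (@eq_sum2 _ _ _ _ F^o) => p q; rewrite (epsM hopf) (eps_antipode hopf repE).
Qed.

Lemma eps_eps_v_scale (z : T) : sum2 (fun p q => eps p *: (eps q *: z)) v = 0.
Proof.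
rewrite -[RHS](scale0r z) -eps_eps_v.
rewrite -(sum2_comp rep _ _ (h := fun k : F^o => (k : F) *: z)); last first.
  by move=> k k1 k2; rewrite scalerDl scalerA.
by apply: eq_sum2 => p q; rewrite scalerA.
Qed.

Lemma eps_u : eps u = 0.
Proof.
rewrite -[RHS]eps_eps_v /u -[LHS](sum2_comp rep _ _ el).
by apply: (@eq_sum2 _ _ _ _ F^o) => p q; rewrite (linZ _ _ el).
Qed.

(** The coefficient of [x] in the counit identity reads [eps a *: 1 + eps x *: u = 1]; applying
    [eps] removes [u], although [u = 0] is not yet known. *)
Lemma eps_a : eps a = 1.
Proof.
have := counitl hopf repE x; rewrite sum2_Dx; last by lint.
have -> : sum2 (fun p q => eps (p * x) *: (q * x)) v = eps x *: u * x.
  rewrite -scalerAl -[RHS](sum2_comp rep _ _ (h := fun z => eps x *: (z * x))); last by lint.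
  by apply: eq_sum2 => p q; rewrite (epsM hopf) -scalerAl scalerA mulrC.
move=> /(congr1 (c 1)); rewrite !(linD _ _ (cl 1)) (linZ _ _ (cl 1)) c1x.
rewrite (c1R (RZ (eps x) bR)) c1X; last exact: RZ.
rewrite c1R; last by apply: sum2_R => // p q pR qR; apply: RZ.
rewrite !addr0 => /(congr1 eps); rewrite (linD (V := F^o) _ _ el) !(linZ (V := F^o) _ _ el).
by rewrite eps_u (eps1 hopf) scaler0 addr0 /GRing.scale /= mulr1.
Qed.

Lemma eps_b : eps b = 1.
Proof.
have := counitr hopf repE x; rewrite sum2_Dx; last by lint.
set u' := sum2 (fun p q => eps q *: p) v.
have u'R : u' \in R by apply: sum2_R => // p q pR qR; apply: RZ.
have -> : sum2 (fun p q => eps (q * x) *: (p * x)) v = eps x *: u' * x.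
  rewrite -scalerAl -[RHS](sum2_comp rep _ _ (h := fun z => eps x *: (z * x))); last by lint.
  by apply: eq_sum2 => p q; rewrite (epsM hopf) -scalerAl scalerA mulrC.
have eu' : eps u' = 0.
  rewrite -[RHS]eps_eps_v /u' -[LHS](sum2_comp rep _ _ el).
  by apply: (@eq_sum2 _ _ _ _ F^o) => p q; rewrite (linZ _ _ el) /GRing.scale /= mulrC.
move=> /(congr1 (c 1)); rewrite !(linD _ _ (cl 1)) !(linZ _ _ (cl 1)) c1x.
rewrite (c1R aR) c1X; last exact: RZ.
rewrite c1R; last by apply: sum2_R => // p q pR qR; apply: RZ.
rewrite scaler0 add0r !addr0 => /(congr1 eps).
rewrite (linD (V := F^o) _ _ el) !(linZ (V := F^o) _ _ el).
by rewrite eu' (eps1 hopf) scaler0 addr0 /GRing.scale /= mulr1.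
Qed.

(** Every term except the [w] part has a leg ending in [x], which [c 0] kills; in the [w] part the
    legs of [Delta q] collapse to the counit. This evaluates quadratic terms of the coassociativity
    identity. *)
Lemma sum2_antipode_c0 q : q \in R ->
  sum2 (fun p1 p2 => S (c 0 p1) * c 0 p2) (Delta q * Delta x) = eps q *: W.
Proof.
move=> qR; rewrite sum2_mulDx; last by lint.
transitivity (sum2 (fun q1 q2 =>
    sum2 (fun p p' => S p * (S q1 * q2) * p') w) (Delta q)).
  apply: eq_sum2R => [|q1 q2 q1R q2R]; first exact: DeltaR.
  rewrite c0X // mulr0 add0r c0X // (lin0 Sl) mul0r add0r.
  rewrite sum2R_0 //; last first.
    by move=> p p' pR p'R; rewrite !mulrA c0X ?RM // (lin0 Sl) mul0r.
  rewrite add0r; apply: eq_sum2R => // p p' pR p'R.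
  by rewrite !c0R ?RM // (antipodeM hopf repE) !mulrA.
rewrite exchange_sum2 -[RHS](sum2_comp rep _ _ (h := fun z => eps q *: z)); last by lint.
apply: eq_sum2 => p p'.
rewrite (sum2_comp rep _ _ (h := fun z => S p * z * p')); last by lint.
by rewrite (antipodel hopf repE) -scalerAr -scalerAl mulr1.
Qed.

Lemma coassoc_at_x (Y : lmodType F) (f : T -> T -> T -> Y) : trilin f ->
  sum2 (fun p1 p2 => f p1 p2 x) (Delta a) + sum2 (fun p1 p2 => f p1 p2 b) (Delta x) +
  sum2 (fun p q => sum2 (fun p1 p2 => f p1 p2 (q * x)) (Delta p * Delta x)) v +
  sum2 (fun p q => sum2 (fun p1 p2 => f p1 p2 q) (Delta p)) w =
  sum2 (f a) (Delta x) + sum2 (f x) (Delta b) +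
  sum2 (fun p q => sum2 (f (p * x)) (Delta q * Delta x)) v +
  sum2 (fun p q => sum2 (f p) (Delta q)) w.
Proof.
move=> ft; have := coassoc hopf repE x ft; have [f1 [f2 f3]] := ft.
rewrite sum2_Dx; last first.
  split=> [q|p]; last by apply: lin_sum2 => p1 p2; apply: f3.
  by apply: lin_sum2z.
rewrite [X in _ = X -> _]sum2_Dx; last first.
  split=> [q|p]; first by apply: lin_sum2 => p1 p2; apply: f1.
  by apply: lin_sum2z.
move=> h; rewrite -[LHS]addrA; move: h; rewrite -[X in X = _ -> _]addrA => h.
transitivity (sum2 (fun p1 p2 => f p1 p2 x) (Delta a) +
  sum2 (fun p1 p2 => f p1 p2 b) (Delta x) +
  (sum2 (fun p q => sum2 (fun p1 p2 => f p1 p2 (q * x)) (Delta (p * x))) v +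
   sum2 (fun p q => sum2 (fun p1 p2 => f p1 p2 q) (Delta p)) w)).
  by congr (_ + (_ + _)); apply: eq_sum2 => p q; rewrite (DeltaM hopf).
rewrite h; congr (_ + _ + _); apply: eq_sum2 => p q; by rewrite (DeltaM hopf).
Qed.

(* Here and in the next two lemmas, coassociativity at x is tested against
   trilinear maps built from [eps \o c 1] and the coefficient maps. *)
Lemma Sb_mul_b : S b * b = 1.
Proof.
(* On the left only [t3 X x b b] survives and gives [S b * b]. On the right [x] with [Delta b] gives
   [eps b = 1], and the quadratic term is [W] times the vanishing sum of [eps p * eps q] over
   [v]. *)
have /coassoc_at_x /= : trilin (fun p q r : T => eps (c 1 p) *: (S (c 0 q) * c 0 r)) by lint.
rewrite sum2_0 => [|p q]; last by rewrite c0x mulr0 scaler0.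
rewrite sum2_Dx; last by lint.
rewrite add0r [X in _ + X = _]sum2R_0 //; last first.
  move=> p q pR qR; apply: sum2R_0 => [|p1 p2 p1R p2R]; first exact: DeltaR.
  by rewrite c1R // (lin0 el) scale0r.
rewrite addr0 [X in _ + X = _]sum2R_0 //; last first.
  move=> p q pR qR; apply: sum2_0 => p1 p2.
  by rewrite c0X // mulr0 scaler0.
rewrite addr0 [X in _ + X = _]sum2R_0 //; last first.
  by move=> p q pR qR; rewrite c1R // (lin0 el) scale0r.
rewrite addr0 [X in _ + X = _]sum2R_0 //; last first.
  by move=> p q pR qR; rewrite (c0X qR) (lin0 Sl) mul0r scaler0.
rewrite addr0 c1R // (lin0 el) scale0r add0r c1x (eps1 hopf) scale1r !c0R //.
move=> ->.
rewrite sum2_0 => [|p q]; last by rewrite scale0r.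
rewrite add0r [X in _ + X]sum2R_0 //; last first.
  by move=> p q pR qR; apply: sum2_0 => q1 q2; rewrite c1R // (lin0 el) scale0r.
rewrite addr0 [X in _ + X](_ : _ = 0) ?addr0; last first.
  rewrite -(eps_eps_v_scale W); apply: eq_sum2R => // p q pR qR; rewrite c1X //.
  rewrite (sum2_comp rep _ _ (h := fun z => eps p *: z)); last by lint.
  by rewrite sum2_antipode_c0.
rewrite -[RHS](scale1r 1) -eps_b -(antipodel hopf repE).
apply: eq_sum2R => [|p q pR qR]; first exact: DeltaR.
by rewrite eps_b scale1r !c0R.
Qed.

Lemma Sa_mul_a : S a * a = 1.
Proof.
(* The mirror image: [Delta a] with [x] gives [eps a = 1] on the left, [t3 X a a x] gives [S a * a]
   on the right. *)
have /coassoc_at_x /= : trilin (fun p q r : T => eps (c 1 r) *: (S (c 0 p) * c 0 q)) by lint.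
rewrite [X in X + _ + _ + _ = _](_ : _ = 1); last first.
  rewrite -[RHS](scale1r 1) -eps_a -(antipodel hopf repE).
  apply: eq_sum2R => [|p q pR qR]; first exact: DeltaR.
  by rewrite c1x (eps1 hopf) scale1r !c0R.
rewrite [X in _ + X + _ + _ = _]sum2_0 => [|p q]; last by rewrite c1R // (lin0 el) scale0r.
rewrite addr0 [X in _ + X + _ = _](_ : _ = 0); last first.
  rewrite -[RHS](eps_eps_v_scale W).
  apply: eq_sum2R => // p q pR qR; rewrite c1X //.
  rewrite (sum2_comp rep _ _ (h := fun z => eps q *: z)); last by lint.
  by rewrite sum2_antipode_c0 // !scalerA mulrC.
rewrite addr0 [X in 1 + X = _]sum2R_0 //; last first.
  by move=> p q pR qR; apply: sum2_0 => q1 q2; rewrite c1R // (lin0 el) scale0r.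
rewrite addr0 => h; apply: esym; rewrite [LHS]h.
rewrite [X in _ + X = _]sum2R_0 ?addr0 //; last first.
  move=> p q pR qR; apply: sum2R_0 => [|q1 q2 q1R q2R]; first exact: DeltaR.
  by rewrite (@c1R q2) // (lin0 el) scale0r.
rewrite [X in _ + X = _]sum2R_0 ?addr0 //; last first.
  by move=> p q pR qR; apply: sum2_0 => q1 q2; rewrite c0X // (lin0 Sl) mul0r scaler0.
rewrite [X in _ + X = _]sum2_0 ?addr0 => [|p q]; last by rewrite c0x (lin0 Sl) mul0r scaler0.
rewrite sum2_Dx; last by lint.
rewrite [X in _ + X = _]sum2R_0 ?addr0 //; last first.
  by move=> p q pR qR; rewrite (@c1R q) // (lin0 el) scale0r.
rewrite [X in _ + X = _]sum2R_0 ?addr0 //; last first.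
  by move=> p q pR qR; rewrite (c0X pR) mulr0 scaler0.
by rewrite c1x (eps1 hopf) scale1r c0x mulr0 scaler0 addr0 !c0R.
Qed.

Lemma u_eq0 : u = 0.
Proof.
have Sau : S a * u = 0.
  (* The map selects [x] in the last two legs: the left side leaves [S a * m], which is zero, the
     right side [S a * u]. *)
  have /coassoc_at_x /= : trilin (fun p q r : T => S (c 0 p) * (eps (c 1 q) *: c 1 r)) by lint.
  rewrite [X in _ + X = _]sum2R_0 ?addr0 //; last first.
    by move=> p q pR qR; apply: sum2_0 => q1 q2; rewrite (@c1R q) // scaler0 mulr0.
  rewrite [X in X + _ + _ = _]sum2R_0 ?add0r; last 2 first.
  - exact: DeltaR.
  - by move=> p q pR qR; rewrite c1R // (lin0 el) scale0r mulr0.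
  rewrite [X in X + _ = _]sum2_0 ?add0r => [|p q]; last by rewrite (@c1R b) // scaler0 mulr0.
  rewrite [LHS](_ : _ = 0) => [h|]; last first.
    transitivity (S a * m); last by rewrite m0 mulr0.
    rewrite -(sum2_comp rep _ _ (h := fun z => S a * z)); last by lint.
    apply: eq_sum2R => // p q pR qR; rewrite sum2_mulDx; last by lint.
    transitivity (sum2 (fun p1 p2 => S a * (S p1 * (eps p2 *: q))) (Delta p)).
      apply: eq_sum2R => [|p1 p2 p1R p2R]; first exact: DeltaR.
      rewrite c1X // c1X // c0R ?RM // (antipodeM hopf repE) -mulrA.
      rewrite (c0X p1R) (lin0 Sl) mul0r addr0.
      rewrite sum2R_0 ?addr0 //; last first.
        by move=> p' q' p'R q'R; rewrite !mulrA c0X ?RM // (lin0 Sl) mul0r.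
      rewrite sum2R_0 ?addr0 // => p' q' p'R q'R.
      by rewrite (@c1R (p2 * q')) ?RM // (lin0 el) scale0r mulr0.
    rewrite (sum2_comp rep _ _ (h := fun z => S a * z)); last by lint.
    congr (_ * _); rewrite -[in RHS](counitr hopf repE p).
    rewrite -[RHS](sum2_comp rep _ _ (h := fun z => S z * q)); last by lint.
    by apply: eq_sum2 => p1 p2; rewrite (linZ _ _ Sl) -scalerAl -scalerAr.
  move: h; rewrite [X in _ + X]sum2R_0 ?addr0 //; last first.
    move=> p q pR qR; apply: sum2R_0 => [|q1 q2 q1R q2R]; first exact: DeltaR.
    by rewrite (@c1R q2) // scaler0 mulr0.
  rewrite [X in _ + X]sum2R_0 ?addr0 //; last first.
    by move=> p q pR qR; apply: sum2_0 => q1 q2; rewrite c0X // (lin0 Sl) mul0r.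
  rewrite [X in _ + X]sum2_0 ?addr0 => [|p q]; last by rewrite c0x (lin0 Sl) mul0r.
  rewrite sum2_Dx; last by lint.
  rewrite [X in _ + X]sum2R_0 ?addr0 //; last first.
    by move=> p q pR qR; rewrite (@c1R q) // scaler0 mulr0.
  rewrite (@c1R a) // (lin0 el) scale0r mulr0 add0r.
  rewrite (@c1R b) // scaler0 mulr0 add0r => h.
  rewrite [RHS]h -[LHS](sum2_comp rep _ _ (h := fun z => S a * z)); last by lint.
  by apply: eq_sum2R => // p q pR qR; rewrite !c1X // c0R.
(* Since [S a] is [- (alpha * sigma b)], it remains to cancel [alpha] and then [sigma b], whose left
   inverse is [sigma (S b)]. *)
have sbu : sigma b * u = 0.
  move: Sau; rewrite SaE mulNr => /eqP; rewrite oppr_eq0 => /eqP h.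
  by rewrite -[LHS]mul1r -a'a -mulrA [alpha * _]mulrA h mulr0.
rewrite -[LHS]mul1r -sigma1 -Sb_mul_b sigmaM ?SR //.
by rewrite -mulrA sbu mulr0.
Qed.

(** Rewriting [S a * a = 1] by the formula for [S a] and conjugating by [alpha] gives a right
    inverse of [sigma b]; it lifts along the surjective [sigma] to a right inverse of [b], which
    must equal the left inverse [S b]. *)
Lemma b_mul_Sb : b * S b = 1.
Proof.
have h1 : sigma b * (- (a * alpha)) = 1.
  have h : alpha * sigma b * a = - 1.
    by rewrite -[RHS]opprK -Sa_mul_a SaE mulNr !opprK.
  rewrite mulrN -[sigma b]mul1r -a'a -!mulrA [alpha * _]mulrA.
  by rewrite [_ * (a * alpha)]mulrA h mulN1r mulrN opprK a'a.
have aaR : - (a * alpha) \in R by apply: (subalgN Rsub); apply: RM.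
case: sigma_aut => _ /(_ _ aaR) [b' [b'R sb']] [si _] _ _.
have bb' : b * b' = 1 by apply: si; rewrite ?RM // sigmaM // sb' sigma1.
suff -> : S b = b' by [].
by rewrite -[LHS]mulr1 -bb' mulrA Sb_mul_b mul1r.
Qed.

(** Apply [Delta] to [x * r = sigma r * x + delta r] and keep the terms with [x] in the first leg
    only: one side leaves [sigma r * b], the other the winding sum times [b]. Precomposing with
    [c 0] extends the functional linearly from [R] to [T]. *)
Lemma sigma_winding r : r \in R ->
  S b * sigma r * b = sum2 (fun p q => eps (sigma (c 0 p)) *: q) (Delta r).
Proof.
move=> rR; rewrite -mulrA.
suff -> : sigma r * b = sum2 (fun p q => eps (sigma (c 0 p)) *: (b * q)) (Delta r).
  rewrite -[LHS](sum2_comp rep _ _ (h := fun z => S b * z)); last by lint.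
  by apply: eq_sum2 => p q; rewrite -scalerAr mulrA Sb_mul_b mul1r.
have fb : bilin (fun p q : T => eps (c 1 p) *: c 0 q) by lint.
have /(congr1 Delta) := xr rR.
rewrite (linD _ _ Dl) !(DeltaM hopf).
move=> /(congr1 (sum2 (fun p q => eps (c 1 p) *: c 0 q))).
rewrite (linD _ _ (sum2_lin HX repE fb)) sum2_Dxmul // sum2_mulDx //.
rewrite [X in _ = _ + X -> _]sum2R_0 ?addr0; last 2 first.
- by apply: DeltaR; apply: deltaR.
- by move=> p q pR qR; rewrite c1R // (lin0 el) scale0r.
move=> h; rewrite -[in LHS](counitl hopf repE (sigma r)).
rewrite -[LHS](sum2_comp rep _ _ (h := fun z => z * b)); last by lint.
have -> : sum2 (fun p q => eps p *: q * b) (Delta (sigma r)) = sum2 (fun p q =>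
    eps (c 1 (p * a)) *: c 0 (q * x) + eps (c 1 (p * x)) *: c 0 (q * b) +
    sum2 (fun p' q' => eps (c 1 (p * (p' * x))) *: c 0 (q * (q' * x))) v +
    sum2 (fun p' q' => eps (c 1 (p * p')) *: c 0 (q * q')) w) (Delta (sigma r)).
  apply: eq_sum2R => [|p q pR qR]; first by apply: DeltaR; apply: sigmaR.
  rewrite c0X // scaler0 add0r c1X // c0R ?RM //.
  rewrite sum2R_0 ?addr0 //; last first.
    by move=> p' q' p'R q'R; rewrite !mulrA c0X ?RM // scaler0.
  rewrite sum2R_0 ?addr0 ?scalerAl // => p' q' p'R q'R.
  by rewrite c1R ?RM // (lin0 el) scale0r.
rewrite -h; apply: eq_sum2R => [|p q pR qR]; first exact: DeltaR.
have xpR t t' : t \in R -> t' \in R -> t * x * t' = t * sigma t' * x + t * delta t'.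
  by move=> tR t'R; rewrite -mulrA xr // mulrDr mulrA.
rewrite c1R ?RM // (lin0 el) scale0r add0r.
have := xpR 1 p R1 pR; rewrite !mul1r => ->.
rewrite (linD _ _ (cl 1)) c1X ?sigmaR // c1R ?deltaR // addr0.
rewrite !c0R ?RM // [X in _ + X = _]sum2R_0 ?addr0 //; last first.
  by move=> p' q' p'R q'R; rewrite c1R ?RM // (lin0 el) scale0r.
(* The quadratic term contributes a multiple of [u * delta q], so it dies with [u]. *)
rewrite (_ : sum2 _ v = 0) ?addr0 //.
transitivity (eps (sigma p) *: (u * delta q)); last by rewrite u_eq0 mul0r scaler0.
rewrite -[RHS](sum2_comp rep _ _ (h := fun z => eps (sigma p) *: (z * delta q))); last by lint.
apply: eq_sum2R => // p' q' p'R q'R; rewrite !xpR //.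
rewrite (linD _ _ (cl 1)) c1X ?RM ?sigmaR // c1R ?RM ?deltaR // addr0.
rewrite (linD _ _ (cl 0)) c0X ?RM ?sigmaR // c0R ?RM ?deltaR // add0r.
by rewrite (epsM hopf) -scalerAl scalerA mulrC.
Qed.

Lemma winding_lin : lin (fun p => eps (sigma (c 0 p)) : F^o).
Proof.
apply: (@lin_comp _ _ _ _ (fun z => eps z : F^o) (fun p => sigma (c 0 p)) el).
by move=> k p q; rewrite cl sigmaL.
Qed.

(* The slices (f (x) id)(Delta r) of the generators r span a finite-dimensional
   space, which is stable under the winding map by coassociativity. *)
Lemma hopf_ore_upper (s0 : seq T) : {subset s0 <= R} ->
  (forall r, r \in R -> exists n, in_span (powV s0 n) r) ->
  (forall t : T, exists rs : seq T, {subset rs <= R} /\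
    t = \sum_(i < size rs) rs`_i * x ^+ i) ->
  exists2 L : seq T, {subset L <= R} & forall s : seq T, exists N, (0 < N)%N /\
    forall n, (Defs.dim_span (powV s n) <=
               (n * N).+1 * Defs.dim_span (powV L (n * N)))%N.
Proof.
move=> s0R s0gen span_x.
pose slice (f : T -> F^o) h := sum2 (fun p q => (f p : F) *: q) (Delta h).
pose U z := exists f : T -> F^o, lin f /\ exists2 r, r \in s0 & z = slice f r.
pose L := flatten [seq [seq p.2 | p <- rep (Delta r)] | r <- s0].
have LR : {subset L <= R}.
  move=> z /flattenP [_ /mapP[r rs ->] /mapP[p pr ->]].
  by have [] := repR (DeltaR (s0R _ rs)) pr.
have UL z : U z -> in_span L z.
  move=> [f [_ [r rs ->]]]; rewrite /slice /tsum big_seq.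
  apply: in_span_sum => p pr; apply: in_spanZ; apply: in_span_mem.
  by apply/flattenP; exists [seq p.2 | p <- rep (Delta r)]; apply: map_f.
exists L => // s.
apply: (@dim_powV_upper F T R (fun r => S b * sigma r * b) (fun r => S b * delta r)
  x (S b * x) b U L) => //.
- move=> _ [f [fl [r rs ->]]]; have rR := s0R _ rs.
  have sR : slice f r \in R.
    by apply: sum2_R => [|p q pR qR]; [exact: DeltaR|exact: RZ].
  (* The convolution of [f] with the winding functional: the winding map sends the slice by [f] to
     the slice by this product. *)
  exists (fun h => sum2 (fun p q => (f p : F) *: (eps (sigma (c 0 q)) : F^o)) (Delta h)).
  have wl := winding_lin.
  have fwl : bilin (fun p q => (f p : F) *: (eps (sigma (c 0 q)) : F^o)).
    split=> [q|p] k z1 z2; first by rewrite fl scalerDl scalerA.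
    by rewrite wl scalerDr !scalerA mulrC.
  split; first exact: lin_comp (sum2_lin HX repE fwl) Dl.
  exists r => //; rewrite sigma_winding //.
  have wsl : bilin (fun p q : T => eps (sigma (c 0 p)) *: q).
    by split=> [q|p]; [apply: lin_scalel|apply: lin_scaler].
  have wDl : lin (fun z => sum2 (fun p q => eps (sigma (c 0 p)) *: q) (Delta z)).
    exact: lin_comp (sum2_lin HX repE wsl) Dl.
  transitivity (sum2 (fun p q => sum2 (fun q1 q2 =>
      (f p : F) *: (eps (sigma (c 0 q1)) *: q2)) (Delta q)) (Delta r)).
    rewrite -(sum2_comp rep _ _ wDl); apply: eq_sum2 => p q; rewrite (linZ _ _ wDl).
    by rewrite (sum2_comp rep _ _ (h := fun z => (f p : F) *: z)) //; apply: lin_scaler.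
  rewrite -(coassoc hopf repE (f := fun p q1 q2 =>
    (f p : F) *: (eps (sigma (c 0 q1)) *: q2))); last first.
    split; [|split] => p q; last by apply: lin_scaler; apply: lin_scaler.
      exact: lin_scalel.
    by apply: lin_scaler; apply: lin_scalel.
  apply: eq_sum2 => p q.
  rewrite -(sum2_comp rep _ _ (h := fun k : F^o => (k : F) *: q)); last first.
    by move=> k k1 k2; rewrite scalerDl scalerA.
  by apply: eq_sum2 => p1 p2; rewrite scalerA.
(* The slice by [eps] is the generator itself, so [U] contains [s0]. *)
- move=> r /s0gen [n rn]; exists n; apply: in_span_powV_gen rn => r' rs.
  by exists (fun h => eps h : F^o); split => //; exists r' => //; rewrite /slice (counitl hopf repE).
- by rewrite mulrA b_mul_Sb mul1r.
- move=> r rR; rewrite -mulrA xr // mulrDr; congr (_ + _).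
  by rewrite -!mulrA [b * _]mulrA b_mul_Sb mul1r.
- by rewrite sigma1 mulr1 Sb_mul_b.
- by move=> k p q pR qR; rewrite sigmaL // mulrDr mulrDl -scalerAr -scalerAl.
- move=> p q pR qR; rewrite sigmaM // -!mulrA; congr (_ * (_ * _)).
  by rewrite [b * _]mulrA b_mul_Sb mul1r.
- by move=> r rR; apply: RM; [apply: SR|apply: deltaR].
- move=> k p q pR qR; case: delta_der => _ dL _.
  by rewrite dL // mulrDr -scalerAr.
- move=> p q pR qR; case: delta_der => _ _ dM.
  rewrite dM // mulrDr -!mulrA; congr (_ * (_ * _) + _).
  by rewrite [b * _]mulrA b_mul_Sb mul1r.
Qed.

End HopfOre.

(** The legs must lie in [R] whenever [z] permits, so that a single choice serves both [T] and [R];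
    hence the case distinction on [in_tensor2 R z]. *)
Lemma exists_rep (F : fieldType) (T : algType F) (X : tensor_data T) (R : {pred T}) :
  is_tensor_data X -> exists rep : TT X -> seq (T * T),
    (forall z, z = \sum_(p <- rep z) t2 X p.1 p.2) /\
    (forall z, in_tensor2 R z -> forall p, p \in rep z -> p.1 \in R /\ p.2 \in R).
Proof.
move=> [_ [_ HX] _ _ _].
have zipE (la lb : seq T) : size la = size lb ->
    \sum_(i < size la) t2 X la`_i lb`_i = \sum_(p <- zip la lb) t2 X p.1 p.2.
  move=> sz; rewrite (big_nth (0, 0)) size_zip -sz minnn big_mkord.
  by apply: eq_bigr => i _; rewrite nth_zip.
suff /choice [rep repP] : forall z : TT X, exists l : seq (T * T),
    z = \sum_(p <- l) t2 X p.1 p.2 /\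
    (in_tensor2 R z -> forall p, p \in l -> p.1 \in R /\ p.2 \in R).
  by exists rep; split=> z; case: (repP z).
move=> z; have [[la [lb [sz laR lbR ->]]]|zR] := pselect (in_tensor2 R z).
  exists (zip la lb); split=> [|_ p pz]; first exact: zipE.
  split; [apply: laR; rewrite -(unzip1_zip (s := la) (t := lb)) ?sz //|
          apply: lbR; rewrite -(unzip2_zip (s := la) (t := lb)) ?sz //]; exact: map_f.
have [la [lb [sz zE]]] := HX z.
by exists (zip la lb); split=> [|/zR//]; rewrite zE; apply: zipE.
Qed.

Theorem theorem2p6 (F : fieldType) (T : algType F) (X : tensor_data T)
  (Delta : T -> TT X) (eps : T -> F) (S : T -> T)
  (R : {pred T}) (sigma delta : T -> T) (x : T)
  (a b : T) (v w : TT X) (alpha beta : T) :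
  is_hopf Delta eps S ->
  is_hopf_subalgebra Delta S R ->
  fin_gen_subalgebra R ->
  is_ore_extension R sigma delta x ->
  a \in R -> b \in R -> in_tensor2 R v -> in_tensor2 R w ->
  Delta x = t2 X a x + t2 X x b + v * t2 X x x + w ->
  alpha \in R -> beta \in R ->
  (exists alpha', [/\ alpha' \in R, alpha * alpha' = 1 & alpha' * alpha = 1]) ->
  S x = alpha * x + beta ->
  GKdim (fun _ : T => true) = adde (GKdim R) 1%E.
Proof.
move=> hopf [Rsub DR SR _] [s0 [s0R s0gen]] [[_ sa] dd xr span_x free_x].
move=> aR bR vR wR Dx alR beR [al' [_ _ a'a]] Sx.
have xr' r : r \in R -> x * r = sigma r * x + delta r.
  by move=> rR; rewrite -xr // addrC subrK.
have [c [cR cl cE]] := exists_coef Rsub span_x free_x.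
have [rep [repE repR]] := exists_rep R (hopf_tensor hopf).
have [L LR upper] := hopf_ore_upper hopf repE Rsub repR DR SR sa dd xr' cR cl cE
  aR bR vR wR Dx alR beR a'a Sx s0R s0gen span_x.
apply/eqP; rewrite eq_le; apply/andP; split.
  exact: GKdim_upper LR upper.
exact: GKdim_lower Rsub span_x free_x.
Qed.
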